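(* Let $k=\mathbf{C}$, let $Q,Q'$ be quivers with rational weights $\theta,\theta'$ and dimension vectors $d,d'$ (all components positive), and let $\overline{\theta}=(\theta_a+\theta'_{a'})_{(a,a')}$, $\bar d=(d_ad'_{a'})_{(a,a')}$. Assume $d$ is coprime and $\theta$-coprime, $d'$ is coprime and $\theta'$-coprime, and $\bar d$ is $\overline{\theta}$-coprime. Let $n,n'$ be integers with $n(\mu_\theta(d)-\theta_a)\in\mathbf{Z}$ for all $a\in Q_0$ and $n'(\mu_{\theta'}(d')-\theta'_{a'})\in\mathbf{Z}$ for all $a'\in Q_0'$. Let $\tilde N_1,\tilde N_2,\tilde N_3$ be the moduli spaces of stable representations of type $\mathbf{1}$ of the covering quivers $\tilde Q,\tilde{Q'},\widetilde{Q\otimes Q'}$ (with the lifted weights), let $\tilde F_1,\tilde F_2,\tilde F_3$ be the natural line bundles on them defined using the integers $n$, $n'$, $nn'$ respectively, and let $\tilde\phi:\tilde N_1\times\tilde N_2\to\tilde N_3$ be the map induced by the tensor product. Then the line bundles $\tilde\phi^*\tilde F_3$ and $$\widetilde{\mathrm{pr}_1}^*\big(\tilde F_1^{\otimes n'\,\mathrm{rk}(d')}\big)\otimes\widetilde{\mathrm{pr}_2}^*\big(\tilde F_2^{\otimes n\,\mathrm{rk}(d)}\big)$$ on $\tilde N_1\times\tilde N_2$ are isomorphic, where $\widetilde{\mathrm{pr}_j}:\tilde N_1\times\tilde N_2\to\tilde N_j$ ($j=1,2$) is the projection map.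
   Context: Quivers and stability. A quiver $Q=(Q_0,Q_1,\mathrm{s},\mathrm{t})$ consists of finite sets $Q_0\neq\emptyset$, $Q_1$ and maps $\mathrm{s},\mathrm{t}:Q_1\to Q_0$. Representations are families $(V_a)_a$ of finite-dimensional vector spaces with linear maps $\rho_\alpha:V_{\mathrm{s}(\alpha)}\to V_{\mathrm{t}(\alpha)}$. For $0\neq d\in\mathbf{N}^{Q_0}$ and a weight $\theta\in\mathbf{R}^{Q_0}$, $\mathrm{rk}(d)=\sum_ad_a$, $\mu_\theta(d)=\left(\sum_a\theta_ad_a\right)/\mathrm{rk}(d)$, and the slope of a non-zero representation is that of its dimension vector; it is $\theta$-stable if every non-zero proper subrepresentation has strictly smaller slope. $d$ is coprime if $\gcd(d_a)=1$, $\theta$-coprime if $\mu_\theta(e)\ne\mu_\theta(d)$ for all $0<e<d$ (componentwise order). The internal product $Q\otimes Q'$ has vertices $Q_0\times Q_0'$ and arrows $(Q_0\times Q_1')\sqcup(Q_1\times Q_0')$, with $(a,\alpha')$ going from $(a,\mathrm{s}(\alpha'))$ to $(a,\mathrm{t}(\alpha'))$ and $(\alpha,a')$ from $(\mathrm{s}(\alpha),a')$ to $(\mathrm{t}(\alpha),a')$. Covering quivers. The covering quiver $\tilde Q$ of $Q$ with respect to $d$ has vertices $(a,\mu)$, $1\le\mu\le d_a$, and arrows $(\alpha,\mu,\nu)$, $1\le\mu\le d_{\mathrm{s}(\alpha)}$, $1\le\nu\le d_{\mathrm{t}(\alpha)}$, from $(\mathrm{s}(\alpha),\mu)$ to $(\mathrm{t}(\alpha),\nu)$;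 its weight is $\tilde\theta_{(a,\mu)}=\theta_a$. Similarly $\tilde{Q'}$ and $\widetilde{Q\otimes Q'}$ with respect to $d'$ and $\bar d$. $\mathbf{1}$ is the dimension vector with all entries $1$. Representation spaces. Fix spaces $V_a,W_{a'}$ of dimensions $d_a,d'_{a'}$ with ordered bases; give $V_a\otimes W_{a'}$ the tensor product basis, ordered by a fixed bijection $\{1,\dots,d_a\}\times\{1,\dots,d'_{a'}\}\to\{1,\dots,d_ad'_{a'}\}$. Let $\mathcal{A}_1,\mathcal{A}_2,\mathcal{A}_3$ be the spaces of representations of $Q$ on $(V_a)$, of $Q'$ on $(W_{a'})$, and of $Q\otimes Q'$ on $(V_a\otimes W_{a'})$, and $\tilde{\mathcal{A}}_1,\tilde{\mathcal{A}}_2,\tilde{\mathcal{A}}_3$ the spaces of representations of type $\mathbf{1}$ of $\tilde Q,\tilde{Q'},\widetilde{Q\otimes Q'}$ on the corresponding basis lines. Taking matrix entries (the $(\mu,\nu)$-th entry of $\rho_\alpha$, from the $\mu$-th basis line of the source to the $\nu$-th of the target, gives the map on the arrow $(\alpha,\mu,\nu)$) identifies $\tilde{\mathcal{A}}_i$ with $\mathcal{A}_i$; the paper identifies the stable loci $\tilde{\mathcal{A}}_i^{\mathrm{s}}$ and $\mathcal{A}_i^{\mathrm{s}}$ accordingly. $T_i$ is the torus with one factor $\mathbf{C}^\times$ per vertex of the covering quiver, modulo the diagonal $\mathbf{C}^\times$, acting on the right by $(\rho g)_\gamma=g_{\mathrm{t}(\gamma)}^{-1}\rho_\gamma g_{\mathrm{s}(\gamma)}$;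 $\tilde p_i:\tilde{\mathcal{A}}_i^{\mathrm{s}}\to\tilde N_i$ is the quotient by $T_i$. The map $\tilde\phi$. The tensor product map $\phi(\rho,\sigma)=((\rho_\alpha\otimes\mathbf{1}_{W_{a'}})_{(\alpha,a')},(\mathbf{1}_{V_a}\otimes\sigma_{\alpha'})_{(a,\alpha')})$, viewed via the identifications as a map $\tilde{\mathcal{A}}_1^{\mathrm{s}}\times\tilde{\mathcal{A}}_2^{\mathrm{s}}\to\tilde{\mathcal{A}}_3^{\mathrm{s}}$, induces $\tilde\phi$ with $\tilde\phi\circ(\tilde p_1\times\tilde p_2)=\tilde p_3\circ\phi$. Natural line bundles. $\tilde F_1$ is the holomorphic line bundle on $\tilde N_1$ (unique up to isomorphism) such that $\tilde p_1^*\tilde F_1$ is $T_1$-isomorphic to $\tilde{\mathcal{A}}_1^{\mathrm{s}}\times\mathbf{C}$ with action $(\tilde\rho,v)t=(\tilde\rho t,\tilde\chi_1(t)^{-1}v)$, $\tilde\chi_1(t)=\prod_{(a,\mu)}t_{(a,\mu)}^{n(\mu_\theta(d)-\theta_a)}$; $\tilde F_2$ and $\tilde F_3$ are defined in the same way for $(\tilde{Q'},\tilde{\theta'})$ with the integer $n'$ and for $\widetilde{Q\otimes Q'}$ with the lift of $\overline{\theta}$ and the integer $nn'$ (exponents $nn'(\mu_{\overline{\theta}}(\bar d)-\overline{\theta}_{(a,a')})$). *)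

(* Defs.v *)
(* The field K below is meant to be R[i] for R : realType.  "differentiable" is
   then Frechet differentiability over the complex numbers, so that
   differentiability at every point of an open subset of C^n is holomorphy. *)
From HB Require Import structures.
From mathcomp Require Import all_boot all_order all_algebra.
From mathcomp Require Import all_classical all_reals all_analysis.
Set Implicit Arguments.
Unset Strict Implicit.
Unset Printing Implicit Defensive.
Import Order.TTheory GRing.Theory Num.Theory.
Import numFieldNormedType.Exports.
Local Open Scope classical_set_scope.
Local Open Scope ring_scope.

Record quiver := Quiver {
  vert : finType;
  arrow : finType;
  src : arrow -> vert;
  tgt : arrow -> vert }.

Section Dimensions.
Variable Q : quiver.
Implicit Types (d e : vert Q -> nat) (th : vert Q -> rat).

Definition rk d : nat := (\sum_a d a)%N.

Definition slope th d : rat := (\sum_a th a * (d a)%:R) / (rk d)%:R.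

Definition coprime_dim d : Prop := \big[gcdn/0%N]_a d a = 1%N.

Definition theta_coprime th d : Prop := forall e,
  (exists a, (0 < e a)%N) -> (forall a, (e a <= d a)%N) ->
  (exists a, (e a < d a)%N) -> slope th e <> slope th d.

End Dimensions.

Section Representations.
Variables (K : fieldType) (Q : quiver).

(* Maps act on row vectors: rho al is the matrix of the map on the arrow al,
   with (mu, nu)-th entry from the mu-th basis line of the source to the
   nu-th basis line of the target. *)
Definition rep (d : vert Q -> nat) : Type :=
  forall al : arrow Q, 'M[K]_(d (src al), d (tgt al)).

(* The family U encodes the subspaces spanned by the rows of the U a. *)
Definition subrep d (rho : rep d) (U : forall a, 'M[K]_(d a)) : Prop :=
  forall al, (U (src al) *m rho al <= U (tgt al))%MS.

Definition stable (th : vert Q -> rat) d (rho : rep d) : Prop :=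
  (exists a, (0 < d a)%N) /\
  forall U, subrep rho U ->
    (exists a, (0 < \rank (U a))%N) -> (exists a, (\rank (U a) < d a)%N) ->
    slope th (fun a => \rank (U a)) < slope th d.

End Representations.

Section InternalProduct.
Variables Q Q' : quiver.

Definition tens_quiver : quiver :=
  @Quiver (vert Q * vert Q')%type
    ((vert Q * arrow Q') + (arrow Q * vert Q'))%type
    (fun be => match be with
               | inl (a, al') => (a, src al')
               | inr (al, a') => (src al, a') end)
    (fun be => match be with
               | inl (a, al') => (a, tgt al')
               | inr (al, a') => (tgt al, a') end).

Definition tens_dim (d : vert Q -> nat) (d' : vert Q' -> nat)
  (v : vert tens_quiver) : nat := (d v.1 * d' v.2)%N.

Definition tens_weight (th : vert Q -> rat) (th' : vert Q' -> rat)
  (v : vert tens_quiver) : rat := th v.1 + th' v.2.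

End InternalProduct.

Section Covering.
Variables (Q : quiver) (d : vert Q -> nat).

Definition cover : quiver :=
  @Quiver {a : vert Q & 'I_(d a)}
    {al : arrow Q & ('I_(d (src al)) * 'I_(d (tgt al)))%type}
    (fun ga => Tagged (fun a => 'I_(d a)) (tagged ga).1)
    (fun ga => Tagged (fun a => 'I_(d a)) (tagged ga).2).

Definition lift_weight (th : vert Q -> rat) (v : vert cover) : rat :=
  th (tag v).

End Covering.

Section RepSpaces.
Variable K : fieldType.

(* Representations of type 1, as coordinate vectors indexed by the arrows. *)
Definition rep1_space (Q : quiver) : Type := 'rV[K]_#|arrow Q|.

Definition rep1_val Q (x : rep1_space Q) (ga : arrow Q) : K :=
  x ord0 (enum_rank ga).

Definition rep1_of_val Q (f : arrow Q -> K) : rep1_space Q :=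
  \row_k f (enum_val k).

Definition rep_of_rep1 Q (x : rep1_space Q) : rep K (fun _ : vert Q => 1%N) :=
  fun ga => (rep1_val x ga)%:M.

Definition stable1 Q (th : vert Q -> rat) : set (rep1_space Q) :=
  [set x | stable th (rep_of_rep1 x)].

(* The identification between the representations of a quiver of dimension d
   and the representations of type 1 of its covering quiver. *)
Definition matrices_of Q (d : vert Q -> nat) (x : rep1_space (cover d)) :
    rep K d :=
  fun al => \matrix_(mu, nu) rep1_val x
    (Tagged (fun al => ('I_(d (src al)) * 'I_(d (tgt al)))%type) (mu, nu)).

Definition entries_of Q (d : vert Q -> nat) (rho : rep K d) :
    rep1_space (cover d) :=
  @rep1_of_val (cover d) (fun ga => rho (tag ga) (tagged ga).1 (tagged ga).2).

(* An element of the torus T is given by a family of non-zero scalars indexed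
   by the vertices; two families differing by an overall scalar define the
   same element of T and act in the same way. *)
Definition torus_family (Q : quiver) (g : vert Q -> K) : Prop :=
  forall v, g v != 0.

Definition torus_act Q (x : rep1_space Q) (g : vert Q -> K) : rep1_space Q :=
  rep1_of_val (fun ga => (g (tgt ga))^-1 * rep1_val x ga * g (src ga)).

(* The exponents are integers under the integrality hypothesis made on n. *)
Definition nat_exponent Q (th : vert Q -> rat) d (n : int) (a : vert Q) : int :=
  Num.floor (n%:~R * (slope th d - th a)).

Definition nat_char Q (th : vert Q -> rat) d (n : int)
    (g : vert (cover d) -> K) : K :=
  \prod_(v : vert (cover d)) g v ^ nat_exponent th d n (tag v).

(* dec a a' is the inverse of the bijection that orders the tensor product
   basis of V_a (x) W_a': the i-th vector of the latter is the tensor product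
   of the basis vectors number (dec a a' i).1 and (dec a a' i).2. *)
Definition tens_rep Q Q' (d : vert Q -> nat) (d' : vert Q' -> nat)
    (dec : forall a a', 'I_(d a * d' a') -> 'I_(d a) * 'I_(d' a'))
    (rho : rep K d) (sig : rep K d') : rep K (tens_dim d d') :=
  fun be => match be return
      'M[K]_(tens_dim d d' (@src (tens_quiver Q Q') be),
             tens_dim d d' (@tgt (tens_quiver Q Q') be)) with
    | inl (a, al') => \matrix_(i, j)
        (((dec a (src al') i).1 == (dec a (tgt al') j).1)%:R *
         sig al' (dec a (src al') i).2 (dec a (tgt al') j).2)
    | inr (al, a') => \matrix_(i, j)
        (rho al (dec (src al) a' i).1 (dec (tgt al) a' j).1 *
         ((dec (src al) a' i).2 == (dec (tgt al) a' j).2)%:R)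
    end.

Definition tens_map Q Q' (d : vert Q -> nat) (d' : vert Q' -> nat)
    (dec : forall a a', 'I_(d a * d' a') -> 'I_(d a) * 'I_(d' a'))
    (x : rep1_space (cover d)) (y : rep1_space (cover d')) :
    rep1_space (cover (tens_dim d d')) :=
  entries_of (tens_rep dec (matrices_of x) (matrices_of y)).

End RepSpaces.

Section Manifolds.
Variable K : numFieldType.

(* A chart is given by two total functions: cm_chart i is only meaningful on
   cm_dom i, and cm_inv i only on its image under cm_chart i. *)
Record cmanifold := CManifold {
  cm_space :> topologicalType;
  cm_dim : nat;
  cm_idx : Type;
  cm_dom : cm_idx -> set cm_space;
  cm_chart : cm_idx -> cm_space -> 'rV[K]_cm_dim;
  cm_inv : cm_idx -> 'rV[K]_cm_dim -> cm_space;
  cm_hausdorff : hausdorff_space cm_space;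
  cm_cover : forall x, exists i, cm_dom i x;
  cm_dom_open : forall i, open (cm_dom i);
  cm_img_open : forall i, open (cm_chart i @` cm_dom i);
  cm_chartK : forall i x, cm_dom i x -> cm_inv i (cm_chart i x) = x;
  cm_chart_cont : forall i x, cm_dom i x -> {for x, continuous (cm_chart i)};
  cm_inv_cont : forall i x, cm_dom i x ->
    {for cm_chart i x, continuous (cm_inv i)};
  cm_trans : forall i j x, cm_dom i x -> cm_dom j x ->
    differentiable (cm_chart j \o cm_inv i) (cm_chart i x) }.

(* Holomorphy on an open set A, of a function and of a map to a manifold;
   values outside A are irrelevant. *)
Definition hol_fun (X : cmanifold) (A : set X) (f : X -> K) : Prop :=
  forall x i, A x -> cm_dom i x -> differentiable (f \o cm_inv i) (cm_chart i x).

Definition hol_on (X Y : cmanifold) (A : set X) (f : X -> Y) : Prop :=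
  forall x, A x -> {for x, continuous f} /\
    forall i j, cm_dom i x -> cm_dom j (f x) ->
      differentiable (cm_chart j \o f \o cm_inv i) (cm_chart i x).

Record hol_map (X Y : cmanifold) := HolMap {
  hol_val :> X -> Y;
  hol_valP : hol_on setT hol_val }.

Lemma differentiable_near (V W : normedModType K) (f g : V -> W) (x : V) :
  (\near x, f x = g x) -> differentiable f x -> differentiable g x.
Proof.
move=> fg df; have fgx : f x = g x by exact: nbhs_singleton fg.
have eqg : g \o shift x = cst (g x) + 'd f x +o_ 0 id.
  apply/eqaddoP => e e0.
  have /eqaddoP/(_ e e0) := diff_locally df.
  have : \forall h \near (0 : V), f (h + x) = g (h + x).
    by move: fg; rewrite (near_shift 0 x) /=; apply: filterS => h; rewrite subr0.
  apply: filterS2 => h hfg; rewrite /= !fctE /= in hfg *.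
  by rewrite -hfg fgx.
have dg : 'd g x = 'd f x :> (V -> W).
  by apply: diff_unique => //; exact: diff_continuous.
by apply/diff_locallyP; rewrite dg; split => //; exact: diff_continuous.
Qed.

Lemma hol_fun_sub (X : cmanifold) (A B : set X) (f : X -> K) :
  B `<=` A -> hol_fun A f -> hol_fun B f.
Proof. by move=> BA hf x i /BA; exact: hf. Qed.

Lemma hol_fun_cst (X : cmanifold) (A : set X) (c : K) : hol_fun A (fun=> c).
Proof. by move=> x i _ _; exact: differentiable_cst. Qed.

Lemma hol_funM (X : cmanifold) (A : set X) (f g : X -> K) :
  hol_fun A f -> hol_fun A g -> hol_fun A (fun x => f x * g x).
Proof.
by move=> hf hg x i Ax ix; apply: differentiableM; [exact: hf|exact: hg].
Qed.

Lemma hol_fun_comp (X Y : cmanifold) (f : hol_map X Y) (A : set Y) (g : Y -> K) :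
  hol_fun A g -> hol_fun (f @^-1` A) (g \o f).
Proof.
move=> hg x i Ax ix; have [j jx] := cm_cover (f x).
have [fc /(_ i j ix jx) df] := hol_valP f (I : setT x).
pose u := cm_chart j \o f \o cm_inv i; pose v := g \o cm_inv j.
have uE : u (cm_chart i x) = cm_chart j (f x) by rewrite /u /= cm_chartK.
have near_eq : \forall z \near cm_chart i x,
    (v \o u) z = (g \o f \o cm_inv i) z.
  have nj : nbhs (f x) (cm_dom j).
    by apply: open_nbhs_nbhs; split=> //; exact: cm_dom_open.
  have : nbhs (cm_inv i (cm_chart i x)) (f @^-1` cm_dom j).
    by rewrite cm_chartK //; exact: fc.
  move/(cm_inv_cont ix) => nz.
  have {}nz : \forall z \near cm_chart i x, cm_dom j (f (cm_inv i z)) := nz.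
  by apply: filterS nz => z /= jz; rewrite /u /v /= cm_chartK.
apply: (differentiable_near near_eq); apply: differentiable_comp => //.
by rewrite uE; exact: hg.
Qed.

Section Affine.
Variable n : nat.

Let dom (i : unit) : set 'rV[K]_n := setT.
Let chart (i : unit) (x : 'rV[K]_n) : 'rV[K]_n := x.

Fact affine_hausdorff : hausdorff_space 'rV[K]_n.
Proof. exact: norm_hausdorff. Qed.

Fact affine_cover x : exists i, dom i x.
Proof. by exists tt. Qed.

Fact affine_dom_open i : open (dom i).
Proof. exact: openT. Qed.

Fact affine_img_open i : open (chart i @` dom i).
Proof. by rewrite image_id; exact: openT. Qed.

Fact affine_trans (i j : unit) x : dom i x -> dom j x ->
  differentiable (chart j \o chart i) (chart i x).
Proof. by move=> _ _; exact: ex_diff. Qed.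

Definition affine : cmanifold :=
  @CManifold 'rV[K]_n n unit dom chart chart affine_hausdorff affine_cover
    affine_dom_open affine_img_open (fun _ _ _ => erefl)
    (fun _ _ _ _ => id) (fun _ _ _ _ => id)
    affine_trans.

End Affine.

Lemma row_mx_continuous m n :
  continuous (fun p : 'rV[K]_m * 'rV[K]_n => row_mx p.1 p.2).
Proof.
move=> p A /nbhs_ballP[e e0 eA]; apply/nbhs_ballP; exists e => //= q [[_ pq1] [_ pq2]].
apply: eA; split=> // i k; rewrite !mxE.
by case: (fintype.split k) => l; [exact: pq1|exact: pq2].
Qed.

Lemma row_mx_differentiable (V : normedModType K) m n
    (f : V -> 'rV[K]_m) (g : V -> 'rV[K]_n) x :
  differentiable f x -> differentiable g x ->
  differentiable (fun z => row_mx (f z) (g z)) x.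
Proof.
move=> df dg; pose h (p : 'rV[K]_m * 'rV[K]_n) := row_mx p.1 p.2.
have h_lin : linear h by move=> c p q; rewrite /h /= scale_row_mx add_row_mx.
pose hM := GRing.isLinear.Build _ _ _ _ _ h_lin.
pose hL : {linear _ -> _} := HB.pack h hM.
have dh p : differentiable h p.
  by rewrite -[h]/(hL : _ -> _); exact/linear_differentiable/row_mx_continuous.
exact: (differentiable_comp (differentiable_pair df dg) (dh _)).
Qed.

Section Product.
Variables X Y : cmanifold.

Let XY : topologicalType := (X * Y)%type.
Let idx : Type := (cm_idx X * cm_idx Y)%type.
Let n := (cm_dim X + cm_dim Y)%N.
Let dom (i : idx) : set XY := cm_dom i.1 `*` cm_dom i.2.
Let chart (i : idx) (p : XY) : 'rV[K]_n :=
  row_mx (cm_chart i.1 p.1) (cm_chart i.2 p.2).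
Let inv (i : idx) (z : 'rV[K]_n) : XY :=
  (cm_inv i.1 (lsubmx z), cm_inv i.2 (rsubmx z)).

Fact prod_hausdorff : hausdorff_space XY.
Proof.
move=> [x y] [x' y'] /= cl; congr pair; apply: cm_hausdorff => A B nA nB.
- have [] := cl (fst @^-1` A) (fst @^-1` B); [exact: cvg_fst|exact: cvg_fst|].
  by move=> p [/= ? ?]; exists p.1.
- have [] := cl (snd @^-1` A) (snd @^-1` B); [exact: cvg_snd|exact: cvg_snd|].
  by move=> p [/= ? ?]; exists p.2.
Qed.

Fact prod_cover x : exists i, dom i x.
Proof.
have [[i ix] [j jx]] := (cm_cover x.1, cm_cover x.2).
by exists (i, j).
Qed.

Fact prod_dom_open i : open (dom i).
Proof.
have -> : dom i = fst @^-1` cm_dom i.1 `&` snd @^-1` cm_dom i.2 by [].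
by apply: openI; apply: (open_comp _ (cm_dom_open _)) => p _;
  [exact: cvg_fst|exact: cvg_snd].
Qed.

Fact prod_img_open i : open (chart i @` dom i).
Proof.
have -> : chart i @` dom i =
    lsubmx @^-1` (@cm_chart X i.1 @` cm_dom i.1) `&`
    rsubmx @^-1` (@cm_chart Y i.2 @` cm_dom i.2).
  apply/seteqP; split=> [_ [p [p1 p2] <-]|z [[x xi xz] [y yi yz]]] /=.
    by rewrite /chart row_mxKl row_mxKr; split; [exists p.1|exists p.2].
  by exists (x, y) => //; rewrite /chart /= xz yz hsubmxK.
apply: openI; apply: open_comp.
- by move=> p _; exact: continuous_lsubmx.
- exact: cm_img_open.
- by move=> p _; exact: continuous_rsubmx.
- exact: cm_img_open.
Qed.

Fact prod_chartK i x : dom i x -> inv i (chart i x) = x.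
Proof.
case: x => x y [/= xi yi]; rewrite /inv /chart row_mxKl row_mxKr /=.
by rewrite !cm_chartK.
Qed.

Lemma for_continuous_pair (S T U : topologicalType) (f : S -> T) (g : S -> U) x :
  {for x, continuous f} -> {for x, continuous g} ->
  {for x, continuous (fun z => (f z, g z))}.
Proof. by move=> fx gx; exact: (cvg_pair fx gx). Qed.

Lemma for_continuous_comp (S T U : topologicalType) (f : S -> T) (g : T -> U) x :
  {for x, continuous f} -> {for f x, continuous g} ->
  {for x, continuous (fun z => g (f z))}.
Proof. by move=> fx gfx; exact: (continuous_comp fx gfx). Qed.

Fact prod_chart_cont i x : dom i x -> {for x, continuous (chart i)}.
Proof.
case: x => x y [/= xi yi].
have cx : {for (x, y), continuous (fun p : XY => cm_chart i.1 p.1)}.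
  by apply: for_continuous_comp; [exact: cvg_fst|exact: cm_chart_cont].
have cy : {for (x, y), continuous (fun p : XY => cm_chart i.2 p.2)}.
  by apply: for_continuous_comp; [exact: cvg_snd|exact: cm_chart_cont].
exact: (for_continuous_comp (for_continuous_pair cx cy)
  (@row_mx_continuous _ _ _)).
Qed.

Fact prod_inv_cont i x : dom i x -> {for chart i x, continuous (inv i)}.
Proof.
case: x => x y [/= xi yi]; apply: for_continuous_pair.
- apply: for_continuous_comp; first exact: continuous_lsubmx.
  by rewrite row_mxKl; exact: cm_inv_cont.
- apply: for_continuous_comp; first exact: continuous_rsubmx.
  by rewrite row_mxKr; exact: cm_inv_cont.
Qed.

Fact prod_trans i j x : dom i x -> dom j x ->
  differentiable (chart j \o inv i) (chart i x).
Proof.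
case: x => x y [/= xi yi] [/= xj yj]; apply: row_mx_differentiable.
- apply: (@differentiable_comp _ _ _ _ lsubmx (cm_chart j.1 \o cm_inv i.1)).
    exact: differentiable_lsubmx.
  by rewrite row_mxKl; exact: cm_trans.
- apply: (@differentiable_comp _ _ _ _ rsubmx (cm_chart j.2 \o cm_inv i.2)).
    exact: differentiable_rsubmx.
  by rewrite row_mxKr; exact: cm_trans.
Qed.

Definition prod_cm : cmanifold :=
  CManifold prod_hausdorff prod_cover prod_dom_open prod_img_open prod_chartK
    prod_chart_cont prod_inv_cont prod_trans.

Fact fst_hol : hol_on setT (fst : prod_cm -> X).
Proof.
move=> p _; split=> [|i j [/= i1 i2] jp]; first exact: cvg_fst.
apply: (@differentiable_comp _ _ _ _ lsubmx (cm_chart j \o cm_inv i.1)).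
  exact: differentiable_lsubmx.
by rewrite row_mxKl; exact: cm_trans.
Qed.

Fact snd_hol : hol_on setT (snd : prod_cm -> Y).
Proof.
move=> p _; split=> [|i j [/= i1 i2] jp]; first exact: cvg_snd.
apply: (@differentiable_comp _ _ _ _ rsubmx (cm_chart j \o cm_inv i.2)).
  exact: differentiable_rsubmx.
by rewrite row_mxKr; exact: cm_trans.
Qed.

Definition pr1_cm : hol_map prod_cm X := HolMap fst_hol.
Definition pr2_cm : hol_map prod_cm Y := HolMap snd_hol.

End Product.

End Manifolds.

Section LineBundles.
Variable K : numFieldType.

Lemma dim_Hom (V W : vectType K) :
  \dim {: 'Hom(V, W)} = (\dim {: V} * \dim {: W})%N.
Proof. by rewrite !dimvf. Qed.

Lemma dim_regular : \dim {: (K^o : vectType K)} = 1%N.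
Proof. by rewrite dimvf. Qed.

Lemma dim_dual (V : vectType K) :
  \dim {: V} = 1%N -> \dim {: 'Hom(V, K^o)} = 1%N.
Proof. by move=> dV; rewrite dim_Hom dV dim_regular. Qed.

(* A holomorphic line bundle: a family of lines with nowhere vanishing local
   frames that differ by holomorphic functions.  lb_frame i is only meaningful
   on lb_dom i; a section is holomorphic when its coordinates with respect to
   the frames are. *)
Record line_bundle (X : cmanifold K) := LineBundle {
  lb_fib :> X -> vectType K;
  lb_dim : forall x, \dim {: lb_fib x} = 1%N;
  lb_idx : Type;
  lb_dom : lb_idx -> set X;
  lb_frame : lb_idx -> forall x, lb_fib x;
  lb_cover : forall x, exists i, lb_dom i x;
  lb_dom_open : forall i, open (lb_dom i);
  lb_frame_neq0 : forall i x, lb_dom i x -> lb_frame i x != 0;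
  lb_trans : forall i j, exists g : X -> K,
    hol_fun (lb_dom i `&` lb_dom j) g /\
    forall x, lb_dom i x -> lb_dom j x ->
      lb_frame i x = g x *: lb_frame j x }.

Definition lb_iso (X : cmanifold K) (L M : line_bundle X) : Prop :=
  exists h : forall x, 'Hom(L x, M x),
    (forall x, lker (h x) = 0%VS) /\
    forall (i : lb_idx L) (j : lb_idx M), exists g : X -> K,
      hol_fun (lb_dom i `&` lb_dom j) g /\
      forall x, lb_dom i x -> lb_dom j x ->
        h x (lb_frame i x) = g x *: lb_frame j x.

Section Pullback.
Variables (X Y : cmanifold K) (f : hol_map X Y) (L : line_bundle Y).

Let dom (i : lb_idx L) : set X := f @^-1` lb_dom i.

Fact pullback_dom_open i : open (dom i).
Proof.
apply: open_comp; last exact: lb_dom_open.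
by move=> x _; have [] := hol_valP f (I : setT x).
Qed.

Fact pullback_trans i j : exists g : X -> K,
    hol_fun (dom i `&` dom j) g /\
    forall x, dom i x -> dom j x ->
      lb_frame i (f x) = g x *: lb_frame j (f x).
Proof.
have [g [hg gE]] := lb_trans i j; exists (g \o f); split.
  exact: (hol_fun_comp (f := f) hg).
by move=> x; exact: gE.
Qed.

Definition pullback : line_bundle X :=
  @LineBundle X (fun x => L (f x)) (fun x => lb_dim L (f x)) (lb_idx L) dom
    (fun i x => lb_frame i (f x)) (fun x => lb_cover L (f x)) pullback_dom_open
    (fun i x => @lb_frame_neq0 _ L i (f x)) pullback_trans.

End Pullback.

Section Trivial.
Variable X : cmanifold K.

Fact triv_trans (i j : unit) : exists g : X -> K,
    hol_fun (setT `&` setT) g /\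
    forall x, setT x -> setT x -> (1 : K^o) = g x *: (1 : K^o).
Proof.
by exists (fun=> 1); split=> [|x _ _]; [exact: hol_fun_cst|rewrite scale1r].
Qed.

Definition triv_lb : line_bundle X :=
  @LineBundle X (fun=> K^o) (fun=> dim_regular) unit (fun=> setT)
    (fun _ _ => 1 : K^o) (fun=> ex_intro _ tt I) (fun=> openT)
    (fun _ _ _ => oner_neq0 K) triv_trans.

End Trivial.

(* For finite-dimensional V and W, V (x) W is realized as Hom (V^*, W), the
   pure tensor of v and w being the map f |-> f(v) w. *)
Section Tensor.
Variables V W : vectType K.

Definition tensor_space : vectType K := 'Hom('Hom(V, K^o), W).

Definition tensor (v : V) (w : W) : tensor_space :=
  linfun (fun f : 'Hom(V, K^o) => (f v : K) *: w).

Lemma tensorE v w f : tensor v w f = (f v : K) *: w.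
Proof.
pose h (f : 'Hom(V, K^o)) := (f v : K) *: w.
have h_lin : linear h.
  by move=> c p q; rewrite /h add_lfunE scale_lfunE scalerDl scalerA.
pose hM := GRing.isLinear.Build _ _ _ _ _ h_lin.
pose hL : {linear _ -> _} := HB.pack h hM.
exact: (lfunE hL).
Qed.

(* The linear form with value 1 at v, when V is a line and v != 0. *)
Definition dual_vect (v : V) : 'Hom(V, K^o) :=
  linfun (fun u : V => (coord [tuple of [:: v]] ord0 u : K^o)).

Lemma dual_vectE v u : dual_vect v u = coord [tuple of [:: v]] ord0 u.
Proof.
pose h : V -> K^o := coord [tuple of [:: v]] ord0.
have h_lin : linear h by move=> c p q; rewrite /h linearP.
pose hM := GRing.isLinear.Build _ _ _ _ _ h_lin.
pose hL : {linear _ -> _} := HB.pack h hM.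
exact: (lfunE hL).
Qed.

Lemma dual_vect1 v : v != 0 -> dual_vect v v = 1.
Proof.
move=> v0; rewrite dual_vectE.
have -> : v = [tuple of [:: v]]`_(ord0 : 'I_1) by [].
by rewrite coord_free ?eqxx //= seq1_free.
Qed.

Lemma line_span (v u : V) : \dim {: V} = 1%N -> v != 0 -> exists c : K, u = c *: v.
Proof.
move=> dV v0; have : u \in <[v]>%VS.
  suff -> : <[v]>%VS = fullv by exact: memvf.
  by apply/eqP; rewrite eqEdim subvf dV dim_vline v0.
by case/vlineP=> c ->; exists c.
Qed.

End Tensor.

Section TensorBundle.
Variables (X : cmanifold K) (L M : line_bundle X).

Let fib (x : X) : vectType K := tensor_space (L x) (M x).
Let idx : Type := (lb_idx L * lb_idx M)%type.
Let dom (i : idx) : set X := lb_dom i.1 `&` lb_dom i.2.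
Let frame (i : idx) (x : X) : fib x := tensor (lb_frame i.1 x) (lb_frame i.2 x).

Fact tens_lb_dim x : \dim {: fib x} = 1%N.
Proof. by rewrite /fib dim_Hom dim_dual lb_dim. Qed.

Fact tens_lb_cover x : exists i, dom i x.
Proof.
have [[i ix] [j jx]] := (lb_cover L x, lb_cover M x).
by exists (i, j).
Qed.

Fact tens_lb_dom_open i : open (dom i).
Proof. by apply: openI; exact: lb_dom_open. Qed.

Fact tens_lb_frame_neq0 i x : dom i x -> frame i x != 0.
Proof.
move=> [i1 i2]; apply/eqP => t0; have /eqP := lb_frame_neq0 i2; apply.
have := tensorE (lb_frame i.1 x) (lb_frame i.2 x) (dual_vect (lb_frame i.1 x)).
rewrite -[tensor _ _]/(frame i x) t0 zero_lfunE dual_vect1 ?scale1r //.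
exact: lb_frame_neq0.
Qed.

Fact tens_lb_trans i j : exists g : X -> K,
  hol_fun (dom i `&` dom j) g /\
  forall x, dom i x -> dom j x -> frame i x = g x *: frame j x.
Proof.
have [g [hg gE]] := lb_trans i.1 j.1; have [k [hk kE]] := lb_trans i.2 j.2.
exists (fun x => g x * k x); split.
  by apply: hol_funM; [apply: hol_fun_sub hg|apply: hol_fun_sub hk];
    move=> x [[? ?] [? ?]].
move=> x [i1 i2] [j1 j2]; apply/lfunP => f.
rewrite scale_lfunE !tensorE gE // kE //.
have -> : f (g x *: lb_frame j.1 x) = g x * f (lb_frame j.1 x) :> K.
  by rewrite linearZ.
by rewrite !scalerA mulrAC.
Qed.

Definition tens_lb : line_bundle X :=
  @LineBundle X fib tens_lb_dim idx dom frame tens_lb_cover tens_lb_dom_open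
    tens_lb_frame_neq0 tens_lb_trans.

End TensorBundle.

Section DualBundle.
Variables (X : cmanifold K) (L : line_bundle X).

Let fib (x : X) : vectType K := 'Hom(L x, K^o).
Let frame (i : lb_idx L) (x : X) : fib x := dual_vect (lb_frame i x).

Fact dual_lb_frame_neq0 i x : lb_dom i x -> frame i x != 0.
Proof.
move=> ix; apply/eqP => /(congr1 (fun t : 'Hom(_, _) => t (lb_frame i x))).
rewrite dual_vect1 ?lb_frame_neq0 // zero_lfunE => /eqP.
by rewrite (negbTE (oner_neq0 K)).
Qed.

Fact dual_lb_trans i j : exists g : X -> K,
  hol_fun (lb_dom i `&` lb_dom j) g /\
  forall x, lb_dom i x -> lb_dom j x -> frame i x = g x *: frame j x.
Proof.
have [g [hg gE]] := lb_trans j i.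
exists g; split; first by apply: hol_fun_sub hg => x [? ?]; split.
move=> x ix jx; apply/lfunP => u.
have [c ->] := line_span u (lb_dim L x) (lb_frame_neq0 ix).
have g0 : g x != 0.
  apply: contraNneq (lb_frame_neq0 jx) => g0.
  by rewrite gE // g0 scale0r.
have ijE : lb_frame i x = (g x)^-1 *: lb_frame j x.
  by rewrite gE // scalerA mulVf // scale1r.
have fZ (f : 'Hom(L x, K^o)) (a : K) v : f (a *: v) = a * f v :> K.
  exact: linearZ.
have -> : frame i x (c *: lb_frame i x) = c :> K.
  by rewrite fZ /frame dual_vect1 ?lb_frame_neq0 ?mulr1.
rewrite scale_lfunE.
have -> : frame j x (c *: lb_frame i x) = c / g x :> K.
  by rewrite ijE scalerA fZ /frame dual_vect1 ?lb_frame_neq0 ?mulr1.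
by rewrite -[RHS]/(g x * (c / g x)) mulrCA mulfV ?mulr1.
Qed.

Definition dual_lb : line_bundle X :=
  @LineBundle X fib (fun x => dim_dual (lb_dim L x)) (lb_idx L)
    (@lb_dom _ L) frame (lb_cover L) (@lb_dom_open _ L)
    dual_lb_frame_neq0 dual_lb_trans.

End DualBundle.

Section Powers.
Variables (X : cmanifold K) (L : line_bundle X).

Fixpoint expn_lb (k : nat) : line_bundle X :=
  if k is k'.+1 then tens_lb (expn_lb k') L else triv_lb X.

Definition exp_lb (k : int) : line_bundle X :=
  match k with
  | Posz k => expn_lb k
  | Negz k => dual_lb (expn_lb k.+1)
  end.

End Powers.

End LineBundles.

Section Moduli.
Variable K : numFieldType.

Definition rep1_cm (Q : quiver) : cmanifold K := affine K #|arrow Q|.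

(* The moduli space of theta-stable representations of type 1: the quotient
   of the (open) stable locus by the torus T, as a complex manifold, mod_proj
   being a holomorphic principal T-bundle.  On the support of a stable
   representation, which is connected, g is determined up to an overall scalar
   by x and torus_act x g, through Laurent monomials in their entries; hence T
   acts freely and local triviality is the existence of holomorphic local
   sections.  Values of mod_proj outside of the stable locus are irrelevant. *)
Record moduli_space (Q : quiver) (th : vert Q -> rat) := ModuliSpace {
  mod_cm :> cmanifold K;
  mod_proj : rep1_space K Q -> mod_cm;
  mod_proj_hol : hol_on (X := rep1_cm Q) (stable1 th) mod_proj;
  mod_proj_surj : forall m, exists2 x, stable1 th x & mod_proj x = m;
  mod_proj_orbit : forall x y, stable1 th x -> stable1 th y ->
    mod_proj x = mod_proj y <->
    exists2 g, torus_family g & y = torus_act x g;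
  mod_section : forall m, exists (A : set mod_cm)
      (s : mod_cm -> rep1_space K Q),
    [/\ open A, A m, hol_on (Y := rep1_cm Q) A s &
        forall m', A m' -> stable1 th (s m') /\ mod_proj (s m') = m'] }.

(* h is a T-isomorphism from the pullback of F to the stable locus, whose fibre
   at x is the fibre of F at mod_proj x and on which t in T acts by
   (x, v) t = (x t, v), to the trivial line bundle with the action
   (x, c) t = (x t, chi(t)^-1 c).  Letting h x be defined on all the fibres of F
   (only the one at mod_proj x matters) avoids a transport along
   mod_proj (x t) = mod_proj x. *)
Definition natural_lb (Q : quiver) (d : vert Q -> nat) (th : vert Q -> rat)
    (n : int) (N : moduli_space (lift_weight (d := d) th))
    (F : line_bundle N) : Prop :=
  exists h : rep1_space K (cover d) -> forall m, 'Hom(F m, K^o),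
  let st := stable1 (K := K) (lift_weight (d := d) th) in
  [/\ forall x, st x -> lker (h x (mod_proj N x)) = 0%VS,
      forall i : lb_idx F, hol_fun (X := rep1_cm (cover d))
        (st `&` mod_proj N @^-1` lb_dom i)
        (fun x => h x (mod_proj N x) (lb_frame i (mod_proj N x)) : K) &
      forall x g, st x -> torus_family g ->
        forall m (v : F m), mod_proj N x = m ->
        h (torus_act x g) m v = (nat_char th n g)^-1 *: h x m v].

End Moduli.

(* Main.v *)
(* Over representations x and y the three natural bundles are trivialized by
   linear forms, determined up to the torus action.  Pulling back the form of F3
   along (x, y) |-> x (x) y and taking powers of the forms of F1 and F2 gives
   forms on both bundles of the statement, and both are multiplied by the same
   scalar when (x, y) is moved by the tori: the character of x (x) y is a
   product over pairs of vertices, in which sum_a d_a (mu - theta_a) = 0 makes the cross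
   terms disappear.  The quotient of the two forms is thus a well-defined
   isomorphism, which is holomorphic because the forms are so along local
   sections of the moduli quotients.  The form of F3 makes sense at x (x) y
   because type 1 stability is preserved by tensor products. *)
Require Import Defs.
From HB Require Import structures.
From mathcomp Require Import all_boot all_order all_algebra.
From mathcomp Require Import all_classical all_reals all_analysis.
From mathcomp Require Import complex ring.
Set Implicit Arguments.
Unset Strict Implicit.
Unset Printing Implicit Defensive.
Import Order.TTheory GRing.Theory Num.Theory.
Import numFieldNormedType.Exports.
Local Open Scope classical_set_scope.
Local Open Scope ring_scope.

(** * Holomorphic functions and maps *)

Section HolomorphicFunctions.
Variable K : numFieldType.
Implicit Types X Y : cmanifold K.

Lemma near_chart X (A : set X) i x : open A -> A x -> cm_dom i x ->
  \forall z \near cm_chart i x, A (cm_inv i z).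
Proof.
move=> oA Ax ix; apply: (cm_inv_cont ix); rewrite cm_chartK //.
exact: open_nbhs_nbhs.
Qed.

(** Differentiability at a point depends only on the germ there, so a function defined through
    arbitrary choices is holomorphic as soon as it agrees near each point with a holomorphic one. *)
Lemma hol_fun_local X (B : set X) (f : X -> K) :
  (forall x, B x -> exists2 A, open A /\ A x &
     exists2 g, hol_fun A g & forall y, A y -> g y = f y) ->
  hol_fun B f.
Proof.
move=> loc x i Bx ix; have [A [oA Ax] [g hg gf]] := loc x Bx.
apply: (@differentiable_near _ _ _ (g \o cm_inv i)); last exact: hg.
by apply: filterS (near_chart oA Ax ix) => z; exact: gf.
Qed.

Lemma hol_funV X (A : set X) (f : X -> K) :
  (forall x, A x -> f x != 0) -> hol_fun A f -> hol_fun A (fun x => (f x)^-1).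
Proof.
move=> f0 hf x i Ax ix; apply: (@differentiableV _ _ (f \o cm_inv i)).
  exact: hf.
by rewrite /= cm_chartK // f0.
Qed.

(** Near a point of [A], continuity keeps [f] inside a single chart domain, where the chain rule
    applies in charts. *)
Lemma hol_fun_comp_on X Y (A : set X) (B : set Y) (f : X -> Y) (g : Y -> K) :
  hol_on A f -> hol_fun B g -> hol_fun (A `&` f @^-1` B) (g \o f).
Proof.
move=> hf hg x i [Ax Bfx] ix; have [j jx] := cm_cover (f x).
have [fc /(_ i j ix jx) df] := hf x Ax.
have near_eq : \forall z \near cm_chart i x,
    ((g \o cm_inv j) \o (cm_chart j \o f \o cm_inv i)) z =
    (g \o f \o cm_inv i) z.
  have : nbhs x (f @^-1` cm_dom j).
    by apply: fc; apply: open_nbhs_nbhs; split=> //; exact: cm_dom_open.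
  rewrite nbhsE => -[C [oC Cx] CA].
  by apply: filterS (near_chart oC Cx ix) => z /CA /= jz; rewrite /= cm_chartK.
apply: (differentiable_near near_eq); apply: differentiable_comp => //=.
by rewrite cm_chartK //; exact: hg.
Qed.

Lemma row_differentiable (V : normedModType K) m (f : V -> 'rV[K]_m) x :
  (forall k, differentiable (fun z => f z ord0 k : K) x) -> differentiable f x.
Proof.
move=> df; have -> : f = \sum_(k < m) (fun z => f z ord0 k *: delta_mx ord0 k).
  by apply/funext => z; rewrite fct_sumE {1}[f z]row_sum_delta.
by apply: differentiable_sum => k; exact: differentiableZl.
Qed.

(** Continuity comes with differentiability: near a point, [f] is a chart followed by
    [f \o cm_inv i], which is differentiable there. *)
Lemma hol_on_affine X m (A : set X) (f : X -> 'rV[K]_m) :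
  (forall k, hol_fun A (fun x => f x ord0 k)) -> hol_on (Y := affine K m) A f.
Proof.
move=> hf x Ax.
have df i : cm_dom i x -> differentiable (f \o cm_inv i) (cm_chart i x).
  by move=> ix; apply: row_differentiable => k; exact: (hf k x i Ax ix).
split=> [|i j ix _]; last exact: df.
have [i ix] := cm_cover x.
have fE : \forall y \near x, (f \o cm_inv i) (cm_chart i y) = f y.
  have : nbhs x (cm_dom i).
    by apply: open_nbhs_nbhs; split=> //; exact: cm_dom_open.
  by apply: filterS => y iy; rewrite /= cm_chartK.
have fc := continuous_comp (cm_chart_cont ix) (differentiable_continuous (df i ix)).
have fx : f x = (f \o cm_inv i) (cm_chart i x) by rewrite /= cm_chartK.
rewrite /prop_for /continuous_at fx; apply: cvg_trans fc.
exact: near_eq_cvg.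
Qed.

Lemma hol_on_coord X m (A : set X) (f : X -> 'rV[K]_m) k :
  hol_on (Y := affine K m) A f -> hol_fun A (fun x => f x ord0 k).
Proof.
move=> hf; have hk : hol_fun (X := affine K m) setT (fun v => v ord0 k).
  by move=> v [] _ _; exact: differentiable_coord.
by apply: hol_fun_sub (hol_fun_comp_on hf hk) => x Ax; split.
Qed.

End HolomorphicFunctions.

(** * Linear forms on line bundles *)

Section LinearForms.
Variable K : numFieldType.

Lemma lker0_neq0 (V W : vectType K) (f : 'Hom(V, W)) v :
  lker f = 0%VS -> v != 0 -> f v != 0.
Proof. by move=> f0; rewrite -memv_ker f0 memv0. Qed.

Lemma lker0_line (V W : vectType K) (f : 'Hom(V, W)) v :
  \dim {: V} = 1%N -> f v != 0 -> lker f = 0%VS.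
Proof.
move=> dV fv; have v0 : v != 0 by apply: contraNneq fv => ->; rewrite linear0.
apply/eqP; rewrite -subv0; apply/subvP => u; rewrite memv_ker memv0.
have [c ->] := line_span u dV v0.
by rewrite linearZ scaler_eq0 (negbTE fv) orbF => /eqP ->; rewrite scale0r.
Qed.

(** The tensor product of the two forms: a tensor is a map from the dual of [V] to [W], and its
    value at [f] contracts the first factor. *)
Definition tensor_form (V W : vectType K) (f : 'Hom(V, K^o)) (g : 'Hom(W, K^o)) :
    'Hom(tensor_space V W, K^o) :=
  linfun (fun t : tensor_space V W => g (t f)).

Lemma tensor_formE (V W : vectType K) (f : 'Hom(V, K^o)) (g : 'Hom(W, K^o)) t :
  tensor_form f g t = g (t f).
Proof.
pose h (t : tensor_space V W) := g (t f).
have h_lin : linear h.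
  by move=> c p q; rewrite /h add_lfunE scale_lfunE linearP.
pose hM := GRing.isLinear.Build _ _ _ _ _ h_lin.
pose hL : {linear _ -> _} := HB.pack h hM.
exact: (lfunE hL).
Qed.

Lemma tensor_form_tensor (V W : vectType K) (f : 'Hom(V, K^o)) (g : 'Hom(W, K^o))
    v w :
  tensor_form f g (tensor v w) = (f v : K) * g w.
Proof. by rewrite tensor_formE tensorE linearZ. Qed.

Lemma tensor_formZ (V W : vectType K) (f : 'Hom(V, K^o)) (g : 'Hom(W, K^o)) a b :
  tensor_form (a *: f) (b *: g) = (a * b) *: tensor_form f g.
Proof.
apply/lfunP => t; rewrite scale_lfunE !tensor_formE scale_lfunE.
have -> : t (a *: f) = a *: t f by exact: linearZ.
by rewrite linearZ scalerA mulrC.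
Qed.

(** For [f] injective on a line, this is evaluation at the vector where [f] is 1, that is, the form
    on the dual line with value 1 at [f]. *)
Definition dual_form (V : vectType K) (f : 'Hom(V, K^o)) :
    'Hom('Hom(V, K^o), K^o) :=
  linfun (fun t : 'Hom(V, K^o) => t ((f^-1)%VF 1)).

Lemma dual_formE (V : vectType K) (f t : 'Hom(V, K^o)) :
  dual_form f t = t ((f^-1)%VF 1).
Proof.
pose h (t : 'Hom(V, K^o)) := t ((f^-1)%VF 1).
have h_lin : linear h.
  by move=> c p q; rewrite /h add_lfunE scale_lfunE.
pose hM := GRing.isLinear.Build _ _ _ _ _ h_lin.
pose hL : {linear _ -> _} := HB.pack h hM.
exact: (lfunE hL).
Qed.

Lemma dual_form_line (V : vectType K) (f t : 'Hom(V, K^o)) v :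
  lker f = 0%VS -> v != 0 -> dual_form f t = (t v : K) / f v.
Proof.
move=> f0 v0; have fv := lker0_neq0 f0 v0.
(* The vector [(f v)^-1 *: v] has value 1 under [f], so by injectivity the inverse of [f] sends 1 to
   it. *)
have -> : dual_form f t = t ((f v : K)^-1 *: v).
  rewrite dual_formE; congr (t _).
  have -> : 1 = f ((f v : K)^-1 *: v) by rewrite linearZ [RHS]mulVf.
  by rewrite lker0_lfunK // f0.
by rewrite linearZ mulrC.
Qed.

End LinearForms.

Section LineForms.
Variable K : numFieldType.
Implicit Types V W : vectType K.

Lemma line_neq0 V : \dim {: V} = 1%N -> exists v : V, v != 0.
Proof.
move=> dV; exists (vpick {: V}); rewrite vpick0.
by apply: contra_eqN dV => /eqP ->; rewrite dimv0.
Qed.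

Lemma tensor_form_lker0 V W (f : 'Hom(V, K^o)) (g : 'Hom(W, K^o)) :
  \dim {: V} = 1%N -> \dim {: W} = 1%N -> lker f = 0%VS -> lker g = 0%VS ->
  lker (tensor_form f g) = 0%VS.
Proof.
move=> dV dW f0 g0; have [v v0] := line_neq0 dV; have [w w0] := line_neq0 dW.
apply: (@lker0_line _ _ _ _ (tensor v w)); first by rewrite dim_Hom dim_dual ?dW.
by rewrite tensor_form_tensor; apply: mulf_neq0; exact: lker0_neq0.
Qed.

Lemma dual_form_lker0 V (f : 'Hom(V, K^o)) :
  \dim {: V} = 1%N -> lker f = 0%VS -> lker (dual_form f) = 0%VS.
Proof.
move=> dV f0; have [v v0] := line_neq0 dV.
apply: (@lker0_line _ _ _ _ f); first exact: dim_dual.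
by rewrite (dual_form_line _ f0 v0) mulfV ?oner_neq0 // lker0_neq0.
Qed.

Lemma scale_lker0 V (f : 'Hom(V, K^o)) c :
  c != 0 -> lker f = 0%VS -> lker (c *: f) = 0%VS.
Proof.
move=> c0 f0; apply/eqP; rewrite -subv0; apply/subvP => u.
by rewrite memv_ker scale_lfunE scaler_eq0 (negbTE c0) -memv_ker f0.
Qed.

Lemma dual_formZ V (f : 'Hom(V, K^o)) c :
  \dim {: V} = 1%N -> c != 0 -> lker f = 0%VS ->
  dual_form (c *: f) = c^-1 *: dual_form f.
Proof.
move=> dV c0 f0; have [v v0] := line_neq0 dV; apply/lfunP => t.
rewrite scale_lfunE (dual_form_line _ f0 v0).
rewrite (dual_form_line _ (scale_lker0 c0 f0) v0) scale_lfunE.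
rewrite -[LHS]/(t v / (c * f v) : K) -[RHS]/(c^-1 * (t v / f v) : K).
by rewrite invfM mulrCA.
Qed.

End LineForms.

(** * Powers of forms and a criterion for isomorphism of line bundles *)

Section BundleForms.
Variables (K : numFieldType) (X : cmanifold K).
Implicit Types (L M : line_bundle X) (A : set X).

Fixpoint expn_form L x (f : 'Hom(L x, K^o)) (k : nat) :
    'Hom(expn_lb L k x, K^o) :=
  match k return 'Hom(expn_lb L k x, K^o) with
  | 0%N => \1%VF
  | k'.+1 => tensor_form (expn_form f k') f
  end.

(** [Negz k] stands for -(k+1), whence the dual of the power [k.+1], as in [exp_lb]. *)
Definition exp_form L x (f : 'Hom(L x, K^o)) (k : int) :
    'Hom(exp_lb L k x, K^o) :=
  match k return 'Hom(exp_lb L k x, K^o) with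
  | Posz k => expn_form f k
  | Negz k => dual_form (expn_form f k.+1)
  end.

Lemma expn_form_lker0 L x (f : 'Hom(L x, K^o)) k :
  lker f = 0%VS -> lker (expn_form f k) = 0%VS.
Proof.
move=> f0; elim: k => [|k IHk] /=.
  by apply/eqP/lker0P => u v; rewrite !id_lfunE.
by apply: tensor_form_lker0 => //; exact: lb_dim.
Qed.

Lemma exp_form_lker0 L x (f : 'Hom(L x, K^o)) k :
  lker f = 0%VS -> lker (exp_form f k) = 0%VS.
Proof.
case: k => k f0; first exact: expn_form_lker0.
by apply: dual_form_lker0; [exact: (lb_dim (expn_lb L k.+1))|exact: expn_form_lker0].
Qed.

Lemma expn_formZ L x (f : 'Hom(L x, K^o)) c k :
  expn_form (c *: f) k = c ^+ k *: expn_form f k.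
Proof.
elim: k => [|k IHk]; first by rewrite expr0 scale1r.
by rewrite /= IHk tensor_formZ exprSr.
Qed.

(** For negative exponents, passing to the dual form inverts the scalar. *)
Lemma exp_formZ L x (f : 'Hom(L x, K^o)) c k :
  c != 0 -> lker f = 0%VS -> exp_form (c *: f) k = c ^ k *: exp_form f k.
Proof.
case: k => k c0 f0; first exact: expn_formZ.
rewrite [LHS]/exp_form expn_formZ.
exact: (dual_formZ (lb_dim (expn_lb L k.+1) x) (expf_neq0 _ c0)
  (expn_form_lker0 _ f0)).
Qed.

(** Holomorphy of a section of the dual bundle over [A], tested on the local frames. *)
Definition hol_form A L (l : forall x, 'Hom(L x, K^o)) : Prop :=
  forall i : lb_idx L, hol_fun (A `&` lb_dom i) (fun x => l x (lb_frame i x) : K).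

Lemma hol_tensor_form A L M (l : forall x, 'Hom(L x, K^o))
    (m : forall x, 'Hom(M x, K^o)) :
  hol_form A l -> hol_form A m ->
  hol_form (L := tens_lb L M) A (fun x => tensor_form (l x) (m x)).
Proof.
move=> hl hm [i j].
have -> : (fun x => tensor_form (l x) (m x)
      (lb_frame ((i, j) : lb_idx (tens_lb L M)) x) : K) = (fun x => (l x (lb_frame i x) : K) * m x (lb_frame j x)).
  by apply/funext => x; exact: tensor_form_tensor.
by apply: hol_funM; [apply: hol_fun_sub (hl i)|apply: hol_fun_sub (hm j)];
  move=> x [Ax [? ?]].
Qed.

(** On the dual frame, the dual form takes the inverse of the value of [l] on the frame. *)
Lemma hol_dual_form A L (l : forall x, 'Hom(L x, K^o)) : open A ->
  (forall x, A x -> lker (l x) = 0%VS) -> hol_form A l ->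
  hol_form (L := dual_lb L) A (fun x => dual_form (l x)).
Proof.
move=> oA l0 hl i; apply: hol_fun_local => x [Ax ix].
exists (A `&` lb_dom (i : lb_idx L)).
  by split=> //; apply: openI => //; exact: lb_dom_open.
have frame0 y : lb_dom i y -> lb_frame (i : lb_idx L) y != 0.
  exact: (@lb_frame_neq0 _ _ L i y).
exists (fun x => (l x (lb_frame (i : lb_idx L) x) : K)^-1).
  by apply: hol_funV (hl i) => y [Ay iy]; rewrite lker0_neq0 ?l0 ?frame0.
move=> y [Ay iy]; rewrite (dual_form_line _ (l0 y Ay) (frame0 y iy)).
by rewrite dual_vect1 ?frame0 // mul1r.
Qed.

Lemma hol_exp_form A L (l : forall x, 'Hom(L x, K^o)) k : open A ->
  (forall x, A x -> lker (l x) = 0%VS) -> hol_form A l ->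
  hol_form (L := exp_lb L k) A (fun x => exp_form (l x) k).
Proof.
move=> oA l0 hl.
have hexpn m : hol_form (L := expn_lb L m) A (fun x => expn_form (l x) m).
  elim: m => [|m IHm]; last exact: hol_tensor_form.
  move=> i; have -> : (fun x => expn_form (l x) 0 (lb_frame i x) : K) = fun=> 1.
    by apply/funext => x; rewrite id_lfunE.
  exact: hol_fun_cst.
case: k => k; first exact: hexpn.
apply: (hol_dual_form (L := expn_lb L k.+1)) => // x Ax.
exact/expn_form_lker0/l0.
Qed.

(** The elements of [S x] are choices that trivialize both fibres at [x]. The isomorphism is [l t x]
    followed by the inverse of [m t x]; two choices change both forms by one scalar, so the
    composite does not depend on [t], and its holomorphy can be tested with a local family of
    choices [s]. *)
Lemma lb_iso_of_forms L M (T : Type) (S : X -> set T)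
    (l : T -> forall x, 'Hom(L x, K^o)) (m : T -> forall x, 'Hom(M x, K^o)) :
  (forall x, S x !=set0) ->
  (forall x t, S x t -> lker (l t x) = 0%VS /\ lker (m t x) = 0%VS) ->
  (forall x t t', S x t -> S x t' -> exists2 c : K, c != 0 &
     l t' x = c *: l t x /\ m t' x = c *: m t x) ->
  (forall x, exists (A : set X) (s : X -> T), [/\ open A, A x,
     forall y, A y -> S y (s y),
     hol_form A (fun y => l (s y) y) & hol_form A (fun y => m (s y) y)]) ->
  lb_iso L M.
Proof.
move=> S0 lm0 lmZ loc; pose t x := projT1 (cid (S0 x)).
have tP x : S x (t x) by rewrite /t; case: cid.
exists (fun x => ((m (t x) x)^-1 \o l (t x) x)%VF); split.
  move=> x; have [l0 m0] := lm0 _ _ (tP x); apply/eqP/lker0P => u v.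
  rewrite !comp_lfunE => uv; move/eqP/lker0P: l0; apply.
  (* On a line an injective form is onto, so its inverse is also a right inverse. *)
  have mV (c : K^o) : m (t x) x ((m (t x) x)^-1%VF c) = c.
    have [w w0] := line_neq0 (lb_dim M x).
    have mw := lker0_neq0 m0 w0.
    have -> : c = m (t x) x (((c : K) / m (t x) x w) *: w).
      by rewrite linearZ -[RHS]/(_ * _) mulfVK.
    by rewrite lker0_lfunK // m0.
  by rewrite -[LHS]mV uv mV.
move=> i j.
exists (fun x => (l (t x) x (lb_frame i x) : K) / m (t x) x (lb_frame j x)).
split; last first.
  move=> x ix jx; have [l0 m0] := lm0 _ _ (tP x).
  have mj := lker0_neq0 m0 (lb_frame_neq0 jx).
  rewrite comp_lfunE; set c : K := _ / _.
  have -> : l (t x) x (lb_frame i x) = m (t x) x (c *: lb_frame j x).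
    by rewrite linearZ -[RHS]/(_ * _) mulfVK.
  by rewrite lker0_lfunK // m0.
apply: hol_fun_local => x [ix jx]; have [A [s [oA Ax As hl hm]]] := loc x.
exists (A `&` (lb_dom i `&` lb_dom j)).
  by split=> //; do 2![apply: openI => //]; exact: lb_dom_open.
(* The same quotient, with the local family [s] in place of the arbitrary choice [t]; the common
   factor [c] cancels. *)
exists (fun y => (l (s y) y (lb_frame i y) : K) * (m (s y) y (lb_frame j y) : K)^-1).
  apply: hol_funM; first by apply: hol_fun_sub (hl i) => y [? []].
  apply: (@hol_fun_sub _ _ (A `&` lb_dom j)); first by move=> y [? []].
  apply: hol_funV (hm j) => y [Ay jy].
  by rewrite lker0_neq0 ?lb_frame_neq0 //; have [] := lm0 _ _ (As y Ay).
move=> y [Ay [iy jy]]; have [c c0 [-> ->]] := lmZ _ _ _ (tP y) (As y Ay).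
by rewrite !scale_lfunE -mulf_div divff // mul1r.
Qed.

End BundleForms.

Lemma hol_form_pullback (K : numFieldType) (X Y : cmanifold K) (f : hol_map X Y)
    (L : line_bundle Y) (A : set Y) (l : forall y, 'Hom(L y, K^o)) :
  hol_form A l -> hol_form (L := pullback f L) (f @^-1` A) (fun x => l (f x)).
Proof.
by move=> hl i; exact: (hol_fun_comp (f := f) (hl i)).
Qed.

(** * Stability of type 1 and tensor products *)

Section Slopes.
Variable Q : quiver.
Implicit Types (th : vert Q -> rat) (d e : vert Q -> nat).

Lemma rk_gt0 d a : (0 < d a)%N -> (0 < rk d)%N.
Proof. by move=> da; rewrite /rk (bigD1 a) //= addn_gt0 da. Qed.

(** Clearing the denominator turns comparisons of slopes into signs of sums that are additive in the
    dimension vector. *)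
Lemma sum_sub_slope th e (m : rat) : (0 < rk e)%N ->
  \sum_a (th a - m) * (e a)%:R = (slope th e - m) * (rk e)%:R.
Proof.
move=> e0; rewrite mulrBl /slope divfK ?pnatr_eq0 -?lt0n //.
rewrite /rk natr_sum mulr_sumr -sumrB.
by apply: eq_bigr => a _; rewrite mulrBl.
Qed.

Lemma slope_lt th e (m : rat) : (0 < rk e)%N ->
  (slope th e < m) = (\sum_a (th a - m) * (e a)%:R < 0).
Proof. by move=> e0; rewrite sum_sub_slope // pmulr_llt0 ?ltr0n // subr_lt0. Qed.

Lemma sum_sub_slope0 th e : (0 < rk e)%N ->
  \sum_a (th a - slope th e) * (e a)%:R = 0.
Proof. by move=> e0; rewrite sum_sub_slope // subrr mul0r. Qed.

Lemma sum_cover d (V : nmodType) (f : vert Q -> V) :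
  \sum_(v : vert (Defs.cover d)) f (tag v) = \sum_a f a *+ d a.
Proof.
transitivity (\sum_a \sum_(i < d a) f a); last first.
  by apply: eq_bigr => a _; rewrite sumr_const card_ord.
by rewrite (@sig_big_dep _ _ _ _ _ xpredT (fun _ => xpredT) (fun a _ => f a)).
Qed.

Lemma rk_cover d : rk (fun _ : vert (Defs.cover d) => 1%N) = rk d.
Proof.
have := sum_cover d (fun=> 1%N); rewrite /rk => ->.
by apply: eq_bigr => a _; exact: natn.
Qed.

Lemma card_cover d : #|vert (Defs.cover d)| = rk d.
Proof. by rewrite -rk_cover /rk sum1_card. Qed.

End Slopes.

Section Stability.
Variables (K : fieldType) (Q : quiver).
Implicit Types (x : rep1_space K Q) (th : vert Q -> rat) (S : {set vert Q}).

(** These are the supports of subrepresentations: in type 1 a subrepresentation is determined by the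
    vertices where it is non-zero. *)
Definition closed_support x S : Prop := forall ga,
  src ga \in S -> rep1_val x ga != 0 -> tgt ga \in S.

(** For non-empty [S], its sign compares the slope of the indicator of [S] with the total slope;
    unlike the slope, it is additive in [S]. *)
Definition relative_weight th (S : {set vert Q}) : rat :=
  \sum_(v in S) (th v - slope th (fun=> 1%N)).

Lemma stable1P th x : stable1 th x <->
  (0 < #|vert Q|)%N /\ forall S, closed_support x S -> S != finset.set0 ->
    S != [set: vert Q]%SET -> relative_weight th S < 0.
Proof.
pose ind (S : {set vert Q}) v : nat := v \in S.
have slopeE S : S != finset.set0 ->
    (slope th (ind S) < slope th (fun=> 1%N)) = (relative_weight th S < 0).
  case/set0Pn=> v vS; rewrite slope_lt; last first.
    by apply: (@rk_gt0 _ _ v); rewrite /ind vS.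
  congr (_ < _); rewrite /relative_weight [RHS]big_mkcond /=.
  by apply: eq_bigr => u _; rewrite /ind; case: (u \in S); rewrite ?mulr1 ?mulr0.
split=> [[[v0 _] st]|[Q0 st]]; split.
- by apply/card_gt0P; exists v0.
- move=> S Sx S0 ST; rewrite -slopeE //.
  (* The subrepresentation that is the whole line over [S] and zero elsewhere. *)
  pose U v : 'M[K]_1 := (ind S v)%:R%:M.
  have rkU : (fun v => \rank (U v)) = ind S.
    apply/funext => v; rewrite /U /ind; case: (v \in S).
      by rewrite mxrank1.
    by rewrite raddf0 mxrank0.
  have := st U; rewrite rkU; apply.
  + move=> ga; rewrite /U /ind /rep_of_rep1 mul_mx_scalar.
    have [sS|] := boolP (src ga \in S); last first.
      by rewrite raddf0 scaler0 sub0mx.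
    have [->|x0] := eqVneq (rep1_val x ga) 0; first by rewrite scale0r sub0mx.
    by rewrite (Sx ga) // submx1.
  + case/set0Pn: S0 => v vS; exists v.
    by rewrite -[\rank _]/((fun v => \rank (U v)) v) rkU /ind vS.
  + have /set0Pn[v vS] : (~: S)%SET != finset.set0.
      by apply: contra ST => /eqP SC; rewrite -[S]finset.setCK SC finset.setC0.
    exists v; rewrite -[\rank _]/((fun v => \rank (U v)) v) rkU /ind.
    by move: vS; rewrite finset.in_setC => vS; rewrite (negbTE vS).
- by case/card_gt0P: Q0 => v _; exists v.
- move=> U Ux [v v0] [w w1].
  (* Ranks are at most 1, so the dimension vector of [U] is the indicator of its support. *)
  pose S := [set v | (0 < \rank (U v))%N]%SET.
  have -> : (fun a => \rank (U a)) = ind S.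
    apply/funext => a; rewrite /ind inE.
    by have := rank_leq_row (U a); case: (\rank (U a)) => [|[|]].
  have S0 : S != finset.set0 by apply/set0Pn; exists v; rewrite inE.
  rewrite slopeE //; apply: st => //.
  + move=> ga; rewrite !inE => sS xga; apply: leq_trans sS _.
    have := mxrankS (Ux ga); rewrite /rep_of_rep1 mul_mx_scalar.
    by rewrite (eqmx_scale _ xga).
  + apply/negP => /eqP/setP/(_ w); rewrite !inE => w0.
    by move: w1; rewrite ltnNge w0.
Qed.

Lemma relative_weightT th : relative_weight th [set: vert Q]%SET = 0.
Proof.
have [/card0_eq Q0|Q0] := posnP #|vert Q|.
  by rewrite /relative_weight big1 // => v _; have := Q0 v; rewrite inE.
have rk1 : (0 < rk (fun _ : vert Q => 1%N))%N by rewrite /rk sum1_card.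
rewrite -(sum_sub_slope0 th rk1) /relative_weight.
by apply: eq_big => [v|v _]; rewrite ?inE ?mulr1.
Qed.

(** The equality case is recorded so that it survives summation over slices. *)
Lemma stable1_relative_weight th x S : stable1 th x -> closed_support x S ->
  relative_weight th S <= 0 ?= iff (S == finset.set0) || (S == [set: vert Q]%SET).
Proof.
move=> /stable1P[_ st] Sx; apply/leifP.
have [->|S0] := eqVneq S finset.set0; first by rewrite /relative_weight big_set0.
have [->|ST] := eqVneq S [set: vert Q]%SET; first by rewrite relative_weightT.
exact: st.
Qed.

End Stability.

(** * Slopes and character exponents under lifting and tensor product *)

Lemma slope_lift (Q : quiver) (d : vert Q -> nat) (th : vert Q -> rat) :
  slope (lift_weight (d := d) th) (fun=> 1%N) = slope th d.
Proof.
rewrite /slope rk_cover; congr (_ / _).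
transitivity (\sum_(v : vert (Defs.cover d)) th (tag v)).
  by apply: eq_bigr => v _; rewrite mulr1.
by rewrite sum_cover; apply: eq_bigr => a _; rewrite mulr_natr.
Qed.

(** A slope is a mean over basis vectors, and the mean of a sum of two functions over a product of
    index sets is the sum of their means. *)
Lemma slope_tens (Q Q' : quiver) (d : vert Q -> nat) (d' : vert Q' -> nat)
    (th : vert Q -> rat) (th' : vert Q' -> rat) :
  (0 < rk d)%N -> (0 < rk d')%N ->
  slope (tens_weight th th') (tens_dim d d') = slope th d + slope th' d'.
Proof.
move=> d0 d'0; rewrite /slope addf_div ?pnatr_eq0 -?lt0n // -natrM.
have -> : rk (tens_dim d d') = (rk d * rk d')%N.
  by rewrite /rk big_distrlr /= pair_bigA.
congr (_ / _); rewrite /rk !natr_sum !big_distrlr /=.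
rewrite [X in _ + X]exchange_big /= -big_split /=.
under [RHS]eq_bigr do rewrite -big_split /=.
rewrite pair_bigA /=; apply: eq_bigr => -[a a'] _ /=.
rewrite /tens_weight /tens_dim /= natrM mulrDl.
by rewrite mulrA [th' a' * _]mulrCA mulrAC [X in _ + X]mulrC.
Qed.

Lemma nat_exponentE (Q : quiver) (d : vert Q -> nat) (th : vert Q -> rat)
    (n : int) a :
  n%:~R * (slope th d - th a) \is a Num.int ->
  (nat_exponent th d n a)%:~R = n%:~R * (slope th d - th a) :> rat.
Proof. exact: floorK. Qed.

(** By additivity of slopes, the product of [n * n'] with the difference of slope and weight splits
    into two integers, so taking floors loses nothing. *)
Lemma nat_exponent_tens (Q Q' : quiver) (d : vert Q -> nat) (d' : vert Q' -> nat)
    (th : vert Q -> rat) (th' : vert Q' -> rat) (n n' : int) a a' :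
  (0 < rk d)%N -> (0 < rk d')%N ->
  n%:~R * (slope th d - th a) \is a Num.int ->
  n'%:~R * (slope th' d' - th' a') \is a Num.int ->
  nat_exponent (tens_weight th th') (tens_dim d d') (n * n') (a, a') =
  n' * nat_exponent th d n a + n * nat_exponent th' d' n' a'.
Proof.
move=> d0 d'0 na n'a'; apply: floor_def.
suff -> : (n * n')%:~R * (slope (tens_weight th th') (tens_dim d d') -
    tens_weight th th' (a, a')) =
  (n' * nat_exponent th d n a + n * nat_exponent th' d' n' a')%:~R :> rat.
  by rewrite lexx intrD ltrDl ltr01.
rewrite intrD !intrM !nat_exponentE // slope_tens // /tens_weight /=; ring.
Qed.

(** The exponents are multiples of deviations from the mean. Hence the character is trivial on the
    diagonal, and the cross terms in [nat_char_tens] cancel. *)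
Lemma sum_nat_exponent (Q : quiver) (d : vert Q -> nat) (th : vert Q -> rat)
    (n : int) :
  (0 < rk d)%N -> (forall a, n%:~R * (slope th d - th a) \is a Num.int) ->
  \sum_(v : vert (Defs.cover d)) nat_exponent th d n (tag v) = 0.
Proof.
move=> d0 nP; apply/eqP; rewrite -(intr_eq0 rat) sum_cover rmorph_sum /=.
apply/eqP; transitivity (- n%:~R * \sum_a (th a - slope th d) * (d a)%:R).
  rewrite mulr_sumr; apply: eq_bigr => a _.
  by rewrite raddfMn /= -mulr_natr nat_exponentE //; ring.
by rewrite sum_sub_slope0 // mulr0.
Qed.

Lemma rk_cover_gt0 (Q : quiver) (d : vert Q -> nat) (v : vert (Defs.cover d)) :
  (0 < rk d)%N.
Proof. exact: (rk_gt0 (leq_ltn_trans (leq0n _) (ltn_ord (tagged v)))). Qed.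

(** * The covering quiver of the product: torus action, stability and characters *)

Section TensorCover.
Variables (K : fieldType) (Q Q' : quiver).
Variables (d : vert Q -> nat) (d' : vert Q' -> nat).
Variable dec : forall a a', 'I_(d a * d' a') -> 'I_(d a) * 'I_(d' a').
Hypothesis dec_bij : forall a a', bijective (@dec a a').

Local Notation V := (vert (Defs.cover d)).
Local Notation V' := (vert (Defs.cover d')).
Local Notation W := (vert (Defs.cover (@tens_dim Q Q' d d'))).

Implicit Types (x : rep1_space K (Defs.cover d)) (y : rep1_space K (Defs.cover d')).

Definition cover_vert (R : quiver) (e : vert R -> nat) a (mu : 'I_(e a)) :
  vert (Defs.cover e) := Tagged (fun a => 'I_(e a)) mu.

Definition cover_arrow (R : quiver) (e : vert R -> nat) al
    (mu : 'I_(e (src al))) (nu : 'I_(e (tgt al))) : arrow (Defs.cover e) :=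
  Tagged (fun al => ('I_(e (src al)) * 'I_(e (tgt al)))%type) (mu, nu).

(** With [factor2] and the inverse [vert_pair], this identifies the vertices of the covering quiver
    of the product with pairs of vertices of the two covering quivers. *)
Definition factor1 (w : W) : V := cover_vert (dec (tagged w : 'I_(_ * _))).1.
Definition factor2 (w : W) : V' := cover_vert (dec (tagged w : 'I_(_ * _))).2.

Fact dec_surj a a' (p : 'I_(d a) * 'I_(d' a')) : exists i, dec i = p.
Proof. by have [g _ gK] := dec_bij a a'; exists (g p). Qed.

Let enc a a' (p : 'I_(d a) * 'I_(d' a')) : 'I_(d a * d' a') :=
  sval (cid (dec_surj p)).

Let encK a a' p : dec (@enc a a' p) = p.
Proof. exact: (svalP (cid (dec_surj p))). Qed.

Let decK a a' i : @enc a a' (dec i) = i.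
Proof. by apply: (bij_inj (dec_bij a a')); rewrite encK. Qed.

Definition vert_pair (v : V) (v' : V') : W :=
  @cover_vert (tens_quiver Q Q') (tens_dim d d') (tag v, tag v')
    (enc (tagged v, tagged v')).

Lemma factor1_pair v v' : factor1 (vert_pair v v') = v.
Proof. by case: v v' => [a mu] [a' mu']; rewrite /factor1 /= encK. Qed.

Lemma factor2_pair v v' : factor2 (vert_pair v v') = v'.
Proof. by case: v v' => [a mu] [a' mu']; rewrite /factor2 /= encK. Qed.

Lemma vert_pairK w : vert_pair (factor1 w) (factor2 w) = w.
Proof.
case: w => [[a a'] i]; rewrite /vert_pair /factor1 /factor2 /=.
by rewrite -surjective_pairing decK.
Qed.

Lemma big_vert_pair (A : Type) (idx : A) (op : Monoid.com_law idx)
    (P : pred W) (F : W -> A) :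
  \big[op/idx]_(w | P w) F w =
  \big[op/idx]_(p | P (vert_pair p.1 p.2)) F (vert_pair p.1 p.2).
Proof.
apply: reindex; exists (fun w => (factor1 w, factor2 w)) => [[v v']|w] _ /=.
  by rewrite factor1_pair factor2_pair.
exact: vert_pairK.
Qed.

Lemma rep1_val_of_val (R : quiver) (f : arrow R -> K) ga :
  rep1_val (rep1_of_val f) ga = f ga.
Proof. by rewrite /rep1_val mxE enum_rankK. Qed.

Lemma rep1_ext (R : quiver) (x y : rep1_space K R) :
  rep1_val x =1 rep1_val y -> x = y.
Proof.
by move=> xy; apply/rowP => k; have := xy (enum_val k); rewrite /rep1_val enum_valK.
Qed.

Lemma tens_map_inr x y al a' i j :
  rep1_val (tens_map dec x y)
    (@cover_arrow (tens_quiver Q Q') (tens_dim d d') (inr (al, a')) i j) =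
  rep1_val (K := K) x
    (cover_arrow (dec (i : 'I_(_ * _))).1 (dec (j : 'I_(_ * _))).1) *
  ((dec (i : 'I_(_ * _))).2 == (dec (j : 'I_(_ * _))).2)%:R.
Proof. by rewrite rep1_val_of_val !mxE. Qed.

Lemma tens_map_inl x y a al' i j :
  rep1_val (tens_map dec x y)
    (@cover_arrow (tens_quiver Q Q') (tens_dim d d') (inl (a, al')) i j) =
  ((dec (i : 'I_(_ * _))).1 == (dec (j : 'I_(_ * _))).1)%:R *
  rep1_val (K := K) y
    (cover_arrow (dec (i : 'I_(_ * _))).2 (dec (j : 'I_(_ * _))).2).
Proof. by rewrite rep1_val_of_val !mxE. Qed.

(** The homomorphism of tori along which the tensor product map is equivariant. *)
Definition torus_tens (g : V -> K) (g' : V' -> K) (w : W) : K :=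
  g (factor1 w) * g' (factor2 w).

Lemma torus_family_tens g g' : torus_family g -> torus_family g' ->
  torus_family (torus_tens g g').
Proof. by move=> g0 g'0 w; rewrite mulf_neq0. Qed.

(** Where an entry can be non-zero, source and target share one factor, whose scalar therefore
    cancels. *)
Lemma tens_map_torus x y g g' : torus_family g -> torus_family g' ->
  tens_map dec (torus_act x g) (torus_act y g') =
  torus_act (tens_map dec x y) (torus_tens g g').
Proof.
move=> g0 g'0; apply: rep1_ext => -[[[a al']|[al a']] [i j]].
- rewrite (tens_map_inl _ _ i j) [RHS]rep1_val_of_val (tens_map_inl _ _ i j).
  rewrite rep1_val_of_val /torus_tens /factor1 /factor2 /=.
  case: eqP => [->|_]; last by rewrite !(mul0r, mulr0).
  rewrite !mul1r; set u := g _; set u1 := g' _; set u2 := g' _.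
  have u_neq0 : u != 0 by exact: g0.
  by rewrite [RHS]mulrCA invfM -!mulrA mulVKf.
- rewrite (tens_map_inr _ _ i j) [RHS]rep1_val_of_val (tens_map_inr _ _ i j).
  rewrite rep1_val_of_val /torus_tens /factor1 /factor2 /=.
  case: eqP => [->|_]; last by rewrite !(mul0r, mulr0).
  rewrite !mulr1; set u := g' _.
  have u_neq0 : u != 0 by exact: g'0.
  by rewrite [_ * u]mulrC [g _ * u]mulrC [RHS]mulrCA invfM -!mulrA mulVKf.
Qed.

(** An arrow of the first covering quiver, placed over the fixed vertex [v'], carries the same
    scalar in the tensor product as in [x]. *)
Lemma closed_slice1 x y (S : {set W}) v' :
  closed_support (tens_map dec x y) S ->
  closed_support x [set v | vert_pair v v' \in S]%SET.
Proof.
case: v' => [a' mu'] Scl [al [mu nu]]; rewrite !inE => sS xga.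
have := Scl (@cover_arrow (tens_quiver Q Q') (tens_dim d d') (inr (al, a'))
  (enc (mu, mu')) (enc (nu, mu'))).
by apply=> //; rewrite tens_map_inr !encK eqxx mulr1.
Qed.

Lemma closed_slice2 x y (S : {set W}) v :
  closed_support (tens_map dec x y) S ->
  closed_support y [set v' | vert_pair v v' \in S]%SET.
Proof.
case: v => [a mu] Scl [al' [mu' nu']]; rewrite !inE => sS yga.
have := Scl (@cover_arrow (tens_quiver Q Q') (tens_dim d d') (inl (a, al'))
  (enc (mu, mu')) (enc (mu, nu'))).
by apply=> //; rewrite tens_map_inl !encK eqxx mul1r.
Qed.

(** Weights and slopes both add up, so each pair contributes one term for each of its factors. *)
Lemma relative_weight_tens (th : vert Q -> rat) (th' : vert Q' -> rat) (S : {set W}) :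
  (0 < rk d)%N -> (0 < rk d')%N ->
  relative_weight (lift_weight (tens_weight th th')) S =
  \sum_v' relative_weight (lift_weight th) [set v | vert_pair v v' \in S]%SET +
  \sum_v relative_weight (lift_weight th') [set v' | vert_pair v v' \in S]%SET.
Proof.
move=> d0 d'0; rewrite /relative_weight !slope_lift slope_tens //.
rewrite big_vert_pair /=.
under eq_bigr => p _.
  rewrite [X in X - _](_ : _ = lift_weight th p.1 + lift_weight th' p.2) //.
  rewrite opprD addrACA; over.
(* The sum over [S] becomes a double sum; for the first term the order is exchanged, so that [v'] is
   fixed in each slice. *)
rewrite big_split /= big_mkcond -(pair_bigA _ (fun v v' =>
  if vert_pair v v' \in S then lift_weight th v - slope th d else 0)) exchange_big /=.
congr (_ + _).
  by apply: eq_bigr => v' _; rewrite -big_mkcond; apply: eq_bigl => v; rewrite inE.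
rewrite big_mkcond -(pair_bigA _ (fun v v' =>
  if vert_pair v v' \in S then lift_weight th' v' - slope th' d' else 0)) /=.
by apply: eq_bigr => v _; rewrite -big_mkcond; apply: eq_bigl => v'; rewrite inE.
Qed.

(* A closed set of vertices of the product meets every copy of a factor in a
   closed set, so its relative weight is a sum of nonpositive relative weights
   of slices, all of which vanish only if each slice is empty or full. *)
Lemma tens_map_stable (th : vert Q -> rat) (th' : vert Q' -> rat) x y :
  stable1 (lift_weight th) x -> stable1 (lift_weight th') y ->
  stable1 (lift_weight (tens_weight th th')) (tens_map dec x y).
Proof.
move=> xst yst; apply/stable1P.
have /stable1P[/card_gt0P[v0 _] _] := xst.
have /stable1P[/card_gt0P[v0' _] _] := yst.
split; first by apply/card_gt0P; exists (vert_pair v0 v0').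
move=> S Scl S0 ST.
rewrite relative_weight_tens ?(rk_cover_gt0 v0) ?(rk_cover_gt0 v0') //.
have slice1 v' := stable1_relative_weight xst (closed_slice1 (v' := v') Scl).
have slice2 v := stable1_relative_weight yst (closed_slice2 (v := v) Scl).
have sum1 := leif_sum (fun v' _ => slice1 v').
have sum2 := leif_sum (fun v _ => slice2 v).
have := leifD (sum1 xpredT) (sum2 xpredT); rewrite !big1_eq addr0 => /leifP.
(* If some slice is neither empty nor full, the inequality is strict, as desired; otherwise [S] will
   be shown to be everything. *)
case: ifP => // /andP[/forallP full1 /forallP full2] _.
case/eqP: ST; apply/setP => w; rewrite finset.in_setT -(vert_pairK w).
case/set0Pn: S0 => u; rewrite -(vert_pairK u).
move: (factor1 w) (factor2 w) (factor1 u) (factor2 u) => v v' s s' ss'.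
(* The slice at [s'] contains [s], so it is full and contains [v]; then the slice at [v] contains
   [s'] and is full too. *)
have vs' : vert_pair v s' \in S.
  have /= /orP[/eqP/setP/(_ s)|/eqP/setP/(_ v)] := full1 s'; last by rewrite !inE.
  by rewrite !inE ss'.
have /= /orP[/eqP/setP/(_ s')|/eqP/setP/(_ v')] := full2 v; last by rewrite !inE.
by rewrite !inE vs'.
Qed.

(** In the product over all pairs, the power of [g v] coming from the exponent at [v] occurs [rk d']
    times, while those coming from the exponents at the [v'] multiply to 1, as these exponents sum
    to 0; likewise for [g']. *)
Lemma nat_char_tens (th : vert Q -> rat) (th' : vert Q' -> rat) (n n' : int)
    (g : V -> K) (g' : V' -> K) :
  (0 < rk d)%N -> (0 < rk d')%N ->
  (forall a, n%:~R * (slope th d - th a) \is a Num.int) ->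
  (forall a', n'%:~R * (slope th' d' - th' a') \is a Num.int) ->
  torus_family g -> torus_family g' ->
  nat_char (tens_weight th th') (n * n') (torus_tens g g') =
  nat_char th n g ^ (n' * (rk d')%:Z) * nat_char th' n' g' ^ (n * (rk d)%:Z).
Proof.
move=> d0 d'0 nP n'P g0 g'0.
have expz_prod (I : finType) (f : I -> K) (k : int) :
    (\prod_i f i) ^ k = \prod_i f i ^ k.
  exact: (big_morph (fun z : K => z ^ k) (fun u v => expfzMl u v k) (exp1rz _ k)).
have expz_sum (I : finType) (u : K) (f : I -> int) : u != 0 ->
    \prod_i u ^ f i = u ^ (\sum_i f i).
  move=> u0; apply/esym/big_morph => [k l|]; [exact: expfzDr | exact: expr0z].
rewrite /nat_char big_vert_pair /=.
transitivity (\prod_v \prod_v'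
  ((g v ^ (n' * nat_exponent th d n (tag v)) *
    g v ^ (n * nat_exponent th' d' n' (tag v'))) *
   (g' v' ^ (n' * nat_exponent th d n (tag v)) *
    g' v' ^ (n * nat_exponent th' d' n' (tag v'))))).
  rewrite pair_bigA /=; apply: eq_bigr => -[v v'] _ /=.
  rewrite /torus_tens factor1_pair factor2_pair nat_exponent_tens //.
  by rewrite expfzMl !expfzDr.
under eq_bigr do rewrite big_split; rewrite big_split /=; congr (_ * _).
- rewrite expz_prod; apply: eq_bigr => v _; rewrite big_split /= prodr_const.
  rewrite expz_sum // -mulr_sumr sum_nat_exponent // mulr0 expr0z mulr1.
  by rewrite exprnP card_cover !exprz_exp mulrCA mulrA.
- rewrite exchange_big expz_prod; apply: eq_bigr => v' _ /=.
  rewrite big_split /= prodr_const.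
  rewrite expz_sum // -mulr_sumr sum_nat_exponent // mulr0 expr0z mul1r.
  by rewrite exprnP card_cover !exprz_exp mulrCA mulrA.
Qed.

End TensorCover.

(** * Forms along sections of moduli quotients *)

Lemma hol_form_sub (K : numFieldType) (X : cmanifold K) (L : line_bundle X)
    (A B : set X) (l : forall x, 'Hom(L x, K^o)) :
  B `<=` A -> hol_form A l -> hol_form B l.
Proof. by move=> BA hl i; apply: hol_fun_sub (hl i) => x [/BA]. Qed.

Section Lifts.
Variables (K : numFieldType) (Q : quiver) (th : vert Q -> rat).
Variables (N : moduli_space K th) (F : line_bundle N).
Variable h : rep1_space K Q -> forall m, 'Hom(F m, K^o).
Hypothesis hol_h : forall i : lb_idx F, hol_fun (X := rep1_cm K Q)
  (stable1 th `&` mod_proj N @^-1` lb_dom i)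
  (fun x => h x (mod_proj N x) (lb_frame i (mod_proj N x)) : K).

(** The holomorphy of [h] on the stable locus is transported along a lift [s] of [f] to
    representations. It is used for local sections ([f] the identity) and for tensor products of
    such sections. *)
Lemma hol_form_lift (Z : cmanifold K) (A : set Z) (f : Z -> N)
    (s : Z -> rep1_space K Q) (i : lb_idx F) :
  open A -> continuous f -> hol_on (Y := rep1_cm K Q) A s ->
  (forall z, A z -> stable1 th (s z) /\ mod_proj N (s z) = f z) ->
  hol_fun (A `&` f @^-1` lb_dom i) (fun z => h (s z) (f z) (lb_frame i (f z)) : K).
Proof.
move=> oA fc hs sP; apply: hol_fun_local => z [Az iz].
exists (A `&` f @^-1` lb_dom i).
  by split=> //; apply: openI => //; apply: open_comp => // *; exact: lb_dom_open.
(* [f z] and [mod_proj N (s z)] agree only on [A], hence the local comparison. *)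
exists (fun z => h (s z) (mod_proj N (s z)) (lb_frame i (mod_proj N (s z))) : K).
  apply: hol_fun_sub (hol_fun_comp_on hs (@hol_h i)) => y [Ay iy].
  by have [sy py] := sP y Ay; split=> //; split=> //=; rewrite py.
by move=> y [/sP[_ ->]].
Qed.

Lemma hol_form_section (A : set N) (s : N -> rep1_space K Q) :
  open A -> hol_on (Y := rep1_cm K Q) A s ->
  (forall m, A m -> stable1 th (s m) /\ mod_proj N (s m) = m) ->
  hol_form A (fun m => h (s m) m).
Proof.
by move=> oA hs sP i; apply: (hol_form_lift (f := id)) => // m; exact: cvg_id.
Qed.

End Lifts.

Section TensorMap.
Variables (K : numFieldType) (Q Q' : quiver).
Variables (d : vert Q -> nat) (d' : vert Q' -> nat).
Variable dec : forall a a', 'I_(d a * d' a') -> 'I_(d a) * 'I_(d' a').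

(** Each coordinate is an entry of one of the two representations times a constant 0 or 1. *)
Lemma hol_on_tens_map (Z : cmanifold K) (A : set Z)
    (s : Z -> rep1_space K (Defs.cover d)) (s' : Z -> rep1_space K (Defs.cover d')) :
  hol_on (Y := rep1_cm K _) A s -> hol_on (Y := rep1_cm K _) A s' ->
  hol_on (Y := rep1_cm K _) A (fun z => tens_map dec (s z) (s' z)).
Proof.
move=> hs hs'; apply: hol_on_affine => k; rewrite -(enum_valK k).
case: (enum_val k) => -[[a al']|[al a']] [i j].
- apply: (eq_ind_r (hol_fun A) _ (funext (fun z =>
    tens_map_inl dec (s z) (s' z) i j))).
  by apply: hol_funM; [exact: hol_fun_cst | exact: hol_on_coord].
- apply: (eq_ind_r (hol_fun A) _ (funext (fun z =>
    tens_map_inr dec (s z) (s' z) i j))).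
  by apply: hol_funM; [exact: hol_on_coord | exact: hol_fun_cst].
Qed.

End TensorMap.

Lemma hol_on_comp_hol (K : numFieldType) (X Y : cmanifold K) (f : hol_map X Y) m
    (A : set Y) (s : Y -> 'rV[K]_m) :
  hol_on (Y := affine K m) A s -> hol_on (Y := affine K m) (f @^-1` A) (s \o f).
Proof.
move=> hs; apply: hol_on_affine => k.
exact: (hol_fun_comp (f := f) (hol_on_coord k hs)).
Qed.

(** * Equivariance of the natural forms and the isomorphism *)

Lemma natural_form_torus (K : numFieldType) (Q : quiver) (d : vert Q -> nat)
    (th : vert Q -> rat) (n : int)
    (N : moduli_space K (lift_weight (d := d) th))
    (F : line_bundle N)
    (h : rep1_space K (Defs.cover d) -> forall m, 'Hom(F m, K^o)) x g m :
  (forall x g, stable1 (lift_weight (d := d) th) x -> torus_family g ->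
     forall m (v : F m), mod_proj N x = m ->
     h (torus_act x g) m v = (nat_char th n g)^-1 *: h x m v) ->
  stable1 (lift_weight (d := d) th) x -> torus_family g -> mod_proj N x = m ->
  h (torus_act x g) m = (nat_char th n g)^-1 *: h x m.
Proof. by move=> hg xs g0 xm; apply/lfunP => v; rewrite scale_lfunE hg. Qed.

Lemma nat_char_neq0 (K : fieldType) (Q : quiver) (d : vert Q -> nat)
    (th : vert Q -> rat) (n : int) (g : vert (Defs.cover d) -> K) :
  torus_family g -> nat_char th n g != 0.
Proof. by move=> g0; apply/prodf_neq0 => v _; exact: expfz_neq0. Qed.

(** An application of [lb_iso_of_forms], the choices over a point being the pairs of stable
    representations above it. *)
Lemma natural_lb_tens_iso (K : numFieldType) (Q Q' : quiver)
  (th : vert Q -> rat) (th' : vert Q' -> rat)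
  (d : vert Q -> nat) (d' : vert Q' -> nat)
  (n n' : int)
  (n_int : forall a, n%:~R * (slope th d - th a) \is a Num.int)
  (n'_int : forall a', n'%:~R * (slope th' d' - th' a') \is a Num.int)
  (dec : forall a a', 'I_(d a * d' a') -> 'I_(d a) * 'I_(d' a'))
  (dec_bij : forall a a', bijective (dec a a'))
  (N1 : moduli_space K (lift_weight (d := d) th))
  (N2 : moduli_space K (lift_weight (d := d') th'))
  (N3 : moduli_space K
          (lift_weight (d := tens_dim d d') (tens_weight th th')))
  (F1 : line_bundle N1) (F2 : line_bundle N2) (F3 : line_bundle N3)
  (F1_natural : natural_lb n F1) (F2_natural : natural_lb n' F2)
  (F3_natural : natural_lb (n * n') F3)
  (phi : hol_map (prod_cm N1 N2) N3)
  (phiE : forall x y,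
     stable1 (lift_weight (d := d) th) x ->
     stable1 (lift_weight (d := d') th') y ->
     phi (mod_proj N1 x, mod_proj N2 y) = mod_proj N3 (tens_map dec x y)) :
  lb_iso (pullback phi F3)
    (tens_lb
      (pullback (pr1_cm N1 N2) (exp_lb F1 (n' * (rk d')%:Z)))
      (pullback (pr2_cm N1 N2) (exp_lb F2 (n * (rk d)%:Z)))).
Proof.
have [h1 [h1_lker hol_h1 h1_torus]] := F1_natural.
have [h2 [h2_lker hol_h2 h2_torus]] := F2_natural.
have [h3 [h3_lker hol_h3 h3_torus]] := F3_natural.
(* A free point [q] avoids transports between fibres along equalities of points. *)
have h1_inj x q : stable1 (lift_weight th) x -> mod_proj N1 x = q ->
    lker (h1 x q) = 0%VS by move=> xs <-; exact: h1_lker.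
have h2_inj y q : stable1 (lift_weight th') y -> mod_proj N2 y = q ->
    lker (h2 y q) = 0%VS by move=> ys <-; exact: h2_lker.
have h3_inj z q : stable1 (lift_weight (tens_weight th th')) z ->
    mod_proj N3 z = q -> lker (h3 z q) = 0%VS by move=> zs <-; exact: h3_lker.
pose T := (rep1_space K (Defs.cover d) * rep1_space K (Defs.cover d'))%type.
pose S (p : prod_cm N1 N2) : set T :=
  [set t | [/\ stable1 (lift_weight th) t.1, stable1 (lift_weight th') t.2,
     mod_proj N1 t.1 = p.1 & mod_proj N2 t.2 = p.2]].
have tens_st p t : S p t ->
    stable1 (lift_weight (tens_weight th th')) (tens_map dec t.1 t.2) /\
    mod_proj N3 (tens_map dec t.1 t.2) = phi p.
  case: p => q q' [s1 s2 /= <- <-].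
  by rewrite phiE //; split=> //; exact: tens_map_stable.
set M := tens_lb _ _.
pose l (t : T) (p : prod_cm N1 N2) : 'Hom(pullback phi F3 p, K^o) :=
  h3 (tens_map dec t.1 t.2) (phi p).
pose m (t : T) (p : prod_cm N1 N2) : 'Hom(M p, K^o) :=
  tensor_form (exp_form (h1 t.1 p.1) (n' * (rk d')%:Z))
              (exp_form (h2 t.2 p.2) (n * (rk d)%:Z)).
apply: (lb_iso_of_forms (S := S) (l := l) (m := m)).
- move=> [q q']; have [x xs xq] := mod_proj_surj q.
  by have [y ys yq] := mod_proj_surj q'; exists (x, y).
- move=> p t tS; have [ts tp] := tens_st p t tS; split; first exact: h3_inj.
  have [s1 s2 p1 p2] := tS.
  by apply: tensor_form_lker0; [exact: (lb_dim (exp_lb F1 _))|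
    exact: (lb_dim (exp_lb F2 _))| |]; apply: exp_form_lker0;
    [exact: h1_inj | exact: h2_inj].
- move=> p [x y] [x' y'] tS tS'; have [/= xs ys xp yp] := tS.
  have [/= x's y's x'p y'p] := tS'.
  have [g g0 x'E] : exists2 g, torus_family g & x' = torus_act x g.
    by apply/(mod_proj_orbit N1 xs x's); rewrite xp x'p.
  have [g' g'0 y'E] : exists2 g, torus_family g & y' = torus_act y g.
    by apply/(mod_proj_orbit N2 ys y's); rewrite yp y'p.
  (* Stability provides a vertex of the covering quiver, hence a positive rank. *)
  have d0 : (0 < rk d)%N.
    by have /stable1P[/card_gt0P[v _] _] := xs; exact: rk_cover_gt0 v.
  have d'0 : (0 < rk d')%N.
    by have /stable1P[/card_gt0P[v _] _] := ys; exact: rk_cover_gt0 v.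
  have gg0 := torus_family_tens dec g0 g'0.
  have [ts tp] := tens_st p (x, y) tS.
  (* The scalar by which the form of [F3] moves; [nat_char_tens] matches it with the one for the
     powers of the forms of [F1] and [F2]. *)
  exists (nat_char (tens_weight th th') (n * n') (torus_tens dec g g'))^-1.
    by rewrite invr_neq0 // nat_char_neq0.
  rewrite /l /m /= x'E y'E; split.
    rewrite tens_map_torus //; exact: (natural_form_torus h3_torus ts gg0 tp).
  rewrite (natural_form_torus h1_torus xs g0 xp).
  rewrite (natural_form_torus h2_torus ys g'0 yp).
  rewrite !exp_formZ ?invr_neq0 ?nat_char_neq0 ?h1_inj ?h2_inj //.
  by rewrite [LHS]tensor_formZ nat_char_tens // invfM !exprz_inv !invr_expz.
- move=> p; have [A1 [s1 [oA1 A1p hs1 s1P]]] := mod_section p.1.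
  have [A2 [s2 [oA2 A2p hs2 s2P]]] := mod_section p.2.
  pose A : set (prod_cm N1 N2) := pr1_cm N1 N2 @^-1` A1 `&` pr2_cm N1 N2 @^-1` A2.
  have oA : open A.
    by apply: openI; apply: open_comp => // q _; [exact: cvg_fst | exact: cvg_snd].
  exists A, (fun q => (s1 q.1, s2 q.2)).
  have sS q : A q -> S q (s1 q.1, s2 q.2).
    by move=> [/= /s1P[? ?] /s2P[? ?]].
  split=> //.
  (* The tensor product of the two local sections is a local lift of [phi] to representations. *)
  + move=> i; apply: (hol_form_lift hol_h3) => //; last by move=> q /sS /tens_st.
      by move=> q; have [] := hol_valP phi (I : setT q).
    apply: hol_on_tens_map.
    * by move=> q [q1 _]; exact: (hol_on_comp_hol (f := pr1_cm N1 N2) hs1 q1).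
    * by move=> q [_ q2]; exact: (hol_on_comp_hol (f := pr2_cm N1 N2) hs2 q2).
  + apply: hol_tensor_form.
    * apply: (@hol_form_sub _ _ _ (pr1_cm N1 N2 @^-1` A1)); first by move=> q [].
      apply: (hol_form_pullback (f := pr1_cm N1 N2) (L := exp_lb F1 _)
        (l := fun q => exp_form (h1 (s1 q) q) (n' * (rk d')%:Z))).
      apply: hol_exp_form => //; last exact: hol_form_section.
      by move=> q /s1P[? ?]; exact: h1_inj.
    * apply: (@hol_form_sub _ _ _ (pr2_cm N1 N2 @^-1` A2)); first by move=> q [].
      apply: (hol_form_pullback (f := pr2_cm N1 N2) (L := exp_lb F2 _)
        (l := fun q => exp_form (h2 (s2 q) q) (n * (rk d)%:Z))).
      apply: hol_exp_form => //; last exact: hol_form_section.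
      by move=> q /s2P[? ?]; exact: h2_inj.
Qed.

Theorem corollary4p9 (R : realType) (Q Q' : quiver)
  (Q_neq0 : (0 < #|vert Q|)%N) (Q'_neq0 : (0 < #|vert Q'|)%N)
  (th : vert Q -> rat) (th' : vert Q' -> rat)
  (d : vert Q -> nat) (d' : vert Q' -> nat)
  (d_gt0 : forall a, (0 < d a)%N) (d'_gt0 : forall a', (0 < d' a')%N)
  (d_coprime : coprime_dim d) (d_theta_coprime : theta_coprime th d)
  (d'_coprime : coprime_dim d') (d'_theta_coprime : theta_coprime th' d')
  (dbar_theta_coprime :
     theta_coprime (tens_weight th th') (tens_dim d d'))
  (n n' : int)
  (n_int : forall a, n%:~R * (slope th d - th a) \is a Num.int)
  (n'_int : forall a', n'%:~R * (slope th' d' - th' a') \is a Num.int)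
  (dec : forall a a', 'I_(d a * d' a') -> 'I_(d a) * 'I_(d' a'))
  (dec_bij : forall a a', bijective (dec a a'))
  (N1 : moduli_space R[i] (lift_weight (d := d) th))
  (N2 : moduli_space R[i] (lift_weight (d := d') th'))
  (N3 : moduli_space R[i]
          (lift_weight (d := tens_dim d d') (tens_weight th th')))
  (F1 : line_bundle N1) (F2 : line_bundle N2) (F3 : line_bundle N3)
  (F1_natural : natural_lb n F1) (F2_natural : natural_lb n' F2)
  (F3_natural : natural_lb (n * n') F3)
  (phi : hol_map (prod_cm N1 N2) N3)
  (phiE : forall x y,
     stable1 (lift_weight (d := d) th) x ->
     stable1 (lift_weight (d := d') th') y ->
     phi (mod_proj N1 x, mod_proj N2 y) = mod_proj N3 (tens_map dec x y)) :
  lb_iso (pullback phi F3)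
    (tens_lb
      (pullback (pr1_cm N1 N2) (exp_lb F1 (n' * (rk d')%:Z)))
      (pullback (pr2_cm N1 N2) (exp_lb F2 (n * (rk d)%:Z)))).
Proof. exact: (natural_lb_tens_iso n_int n'_int dec_bij). Qed.
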